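(* Let $\mathscr{H}$ be a complex Hilbert space, $d,n\ge1$, and let $\mathbb{A}=[\mathbf{A_{ij}}]_{n\times n}$ be an $n\times n$ operator matrix, where $\mathbf{A_{ij}}\in\mathbb{B}^d(\mathscr{H})$, $1\le i,j\le n$. If $f,g:[0,\infty)\to[0,\infty)$ are continuous functions satisfying $f(\lambda)g(\lambda)=\lambda$ for all $\lambda\in[0,\infty)$, then $$w_e(\mathbb{A})\le w\left([a_{ij}]_{n\times n}\right),$$ where $$a_{ij}=\begin{cases} w_e(\mathbf{A_{ij}}) & \text{when } i=j,\\ \sqrt{w_e\left(f^2(|\mathbf{A_{ji}}|)+g^2(|\mathbf{A_{ij}^*}|)\right)\,w_e\left(f^2(|\mathbf{A_{ij}}|)+g^2(|\mathbf{A_{ji}^*}|)\right)} & \text{when } i<j,\\ 0 & \text{when } i>j.\end{cases}$$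
   Context: $\mathbb{B}(\mathscr{H})$ is the algebra of bounded linear operators on the complex Hilbert space $\mathscr{H}$, and $\mathbb{B}^d(\mathscr{H})$ is the set of $d$-tuples of such operators. For $T\in\mathbb{B}(\mathscr{H})$, $|T|=(T^*T)^{1/2}$. For a $d$-tuple $\mathbf{T}=(T_1,\ldots,T_d)$ of bounded operators on a complex Hilbert space, the Euclidean operator radius is $w_e(\mathbf{T})=\sup\{(\sum_{k=1}^d|\langle T_kx,x\rangle|^2)^{1/2}:\|x\|=1\}$. Operations on tuples are componentwise: $\mathbf{T}^*=(T_1^*,\ldots,T_d^* )$, $|\mathbf{T}|=(|T_1|,\ldots,|T_d|)$, sums are componentwise, and $f^2(|\mathbf{T}|)=(f(|T_1|)^2,\ldots,f(|T_d|)^2)$ via continuous functional calculus (similarly for $g$). $\mathbf{A_{ij}^*}$ means $(\mathbf{A_{ij}})^*$. If $\mathbf{A_{ij}}=(A_{ij}^1,\ldots,A_{ij}^d)$, the operator matrix $[\mathbf{A_{ij}}]_{n\times n}$ is the $d$-tuple $([A_{ij}^1]_{n\times n},\ldots,[A_{ij}^d]_{n\times n})$ of operators on $\oplus_{i=1}^n\mathscr{H}$. For a complex $n\times n$ matrix $M$, $w(M)=\sup\{|\langle Mx,x\rangle|:x\in\mathbb{C}^n,\|x\|=1\}$ is its numerical radius. *)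

(* Defs.v *)
From HB Require Import structures.
From mathcomp Require Import all_boot all_order all_algebra.
From mathcomp Require Import ring sesquilinear complex.
From mathcomp Require Import all_classical all_reals all_analysis.

Set Implicit Arguments.
Unset Strict Implicit.
Unset Printing Implicit Defensive.

Import Order.TTheory GRing.Theory Num.Theory Num.Def.
Import numFieldNormedType.Exports.

Local Open Scope classical_set_scope.
Local Open Scope ring_scope.

Section InnerTheory.
Variables (C : numClosedFieldType) (U : lmodType C) (form : {dot U for Num.conj}).

Lemma dot_CauchySchwarz (u v : U) : `|form u v| ^+ 2 <= form u u * form v v.
Proof.
have [->|v0] := eqVneq v 0; first by rewrite (linear0r form) normr0 expr0n mulr_ge0 ?dnorm_ge0.
have vv_gt0 : 0 < form v v by rewrite dnorm_gt0.
have vvJ : (form v v)^* = form v v by rewrite geC0_conj// ltW.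
have vuE : form v u = (form u v)^* by rewrite (hermC form) expr0 mul1r.
have : 0 <= form (form v v *: u - form u v *: v) (form v v *: u - form u v *: v).
  exact: dnorm_ge0.
rewrite linearBl !linearBr !linearZl_LR !linearZr_LR /= vvJ vuE.
rewrite (_ : _ - _ = form v v * (form u u * form v v - `|form u v| ^+ 2)).
  by rewrite pmulr_rge0// subr_ge0.
by rewrite normCK /GRing.scale/=; ring.
Qed.

Lemma dot_triangle (u v : U) :
  sqrtC (form (u + v) (u + v)) <= sqrtC (form u u) + sqrtC (form v v).
Proof.
rewrite -ler_sqr ?nnegrE ?addr_ge0 ?sqrtC_ge0 ?dnorm_ge0//.
rewrite sqrrD !sqrtCK dnormD [leRHS]addrAC lerD2l.
rewrite [leLHS](_ : _ = 'Re (form u v) *+ 2); last first.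
  by rewrite ReE -mulr_natr divfK.
rewrite lerMn2r/=; apply: (le_trans (leif_Re_Creal _)).
rewrite -ler_sqr ?nnegrE ?mulr_ge0 ?sqrtC_ge0 ?dnorm_ge0//.
by rewrite exprMn !sqrtCK dot_CauchySchwarz.
Qed.

End InnerTheory.
Local Open Scope complex_scope.

HB.mixin Record CompleteNormedModule_isHilbert (R : realType) H
    & CompleteNormedModule R[i] H := {
  inner : {dot H for Num.conj};
  inner_normE : forall x : H, inner x x = `|x| ^+ 2
}.

#[short(type="hilbertType")]
HB.structure Definition Hilbert (R : realType) :=
  {H of CompleteNormedModule R[i] H & CompleteNormedModule_isHilbert R H}.

HB.structure Definition BoundedOp (R : realType) (H : hilbertType R) :=
  {T of @GRing.Linear R[i] H H *:%R T & @isContinuous H H T}.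

Notation "''B' ( H )" := (BoundedOp.type H) (format "''B' ( H )") : type_scope.

Section BoundedOpAlgebra.
Variables (R : realType) (H : hilbertType R).
Implicit Types (S T : 'B(H)) (a : R[i]).

Definition mkbop (f : H -> H) (lf : linear f) (cf : continuous f) : 'B(H) :=
  HB.pack f (@GRing.isLinear.Build R[i] H H *:%R f lf)
            (@isContinuous.Build H H f cf).

Lemma mkbopE f lf cf x : @mkbop f lf cf x = f x. Proof. by []. Qed.

Lemma bopP S T : S =1 T -> S = T.
Proof.
case: S => f [[fA] [fZ] [fc]]; case: T => g [[gA] [gZ] [gc]] /= fg.
have {}fg : f = g by exact: funext.
by case: _ / fg in gA gZ gc *; congr BoundedOp.Pack; congr BoundedOp.Class;
  f_equal; exact: Prop_irrelevance.
Qed.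


HB.instance Definition _ := gen_eqMixin 'B(H).
HB.instance Definition _ := gen_choiceMixin 'B(H).

Fact bop0_linear : linear (fun _ : H => 0 : H).
Proof. by move=> a x y; rewrite scaler0 addr0. Qed.
Fact bop0_continuous : continuous (fun _ : H => 0 : H).
Proof. exact: cst_continuous. Qed.
Definition bop0 := mkbop bop0_linear bop0_continuous.

Fact bop_add_linear S T : linear (fun x : H => S x + T x).
Proof. by move=> a x y; rewrite !linearP scalerDr addrACA. Qed.
Fact bop_add_continuous S T : continuous (fun x : H => S x + T x).
Proof. by move=> x; apply: cvgD; exact: cts_fun. Qed.
Definition bop_add S T := mkbop (bop_add_linear S T) (@bop_add_continuous S T).

Fact bop_scale_linear a T : linear (fun x : H => a *: T x).
Proof. by move=> b x y; rewrite linearP scalerDr !scalerA mulrC. Qed.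
Fact bop_scale_continuous a T : continuous (fun x : H => a *: T x).
Proof. by move=> x; apply: cvgZr; exact: cts_fun. Qed.
Definition bop_scale a T := mkbop (bop_scale_linear a T) (@bop_scale_continuous a T).

Fact bop1_linear : linear (fun x : H => x).
Proof. by []. Qed.
Fact bop1_continuous : continuous (fun x : H => x).
Proof. by move=> x; exact: cvg_id. Qed.
Definition bop1 := mkbop bop1_linear bop1_continuous.

Fact bop_mul_linear S T : linear (fun x : H => S (T x)).
Proof. by move=> a x y; rewrite !linearP. Qed.
Fact bop_mul_continuous S T : continuous (fun x : H => S (T x)).
Proof. by move=> x; apply: continuous_comp; exact: cts_fun. Qed.
Definition bop_mul S T := mkbop (bop_mul_linear S T) (@bop_mul_continuous S T).

Fact bop_addA : associative bop_add.
Proof. by move=> S T U; apply: bopP => x; exact: addrA. Qed.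
Fact bop_addC : commutative bop_add.
Proof. by move=> S T; apply: bopP => x; exact: addrC. Qed.
Fact bop_add0 : left_id bop0 bop_add.
Proof. by move=> T; apply: bopP => x; exact: add0r. Qed.
Fact bop_addN : left_inverse bop0 (bop_scale (-1)) bop_add.
Proof.
by move=> T; apply: bopP => x; rewrite !mkbopE scaleN1r addNr.
Qed.
HB.instance Definition _ := GRing.isZmodule.Build 'B(H) bop_addA bop_addC bop_add0 bop_addN.

Fact bop_mulA : associative bop_mul.
Proof. by move=> S T U; apply: bopP. Qed.
Fact bop_mul1l : left_id bop1 bop_mul.
Proof. by move=> T; apply: bopP. Qed.
Fact bop_mul1r : right_id bop1 bop_mul.
Proof. by move=> T; apply: bopP. Qed.
Fact bop_mulDl : left_distributive bop_mul bop_add.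
Proof. by move=> S T U; apply: bopP. Qed.
Fact bop_mulDr : right_distributive bop_mul bop_add.
Proof. by move=> S T U; apply: bopP => x; rewrite !mkbopE linearD. Qed.
HB.instance Definition _ :=
  GRing.Zmodule_isPzRing.Build 'B(H) bop_mulA bop_mul1l bop_mul1r bop_mulDl bop_mulDr.

Fact bop_scaleA a b T : bop_scale a (bop_scale b T) = bop_scale (a * b) T.
Proof. by apply: bopP => x; exact: scalerA. Qed.
Fact bop_scale1 : left_id 1 bop_scale.
Proof. by move=> T; apply: bopP => x; exact: scale1r. Qed.
Fact bop_scaleDr : right_distributive bop_scale +%R.
Proof. by move=> a S T; apply: bopP => x; exact: scalerDr. Qed.
Fact bop_scaleDl T : {morph bop_scale^~ T : a b / a + b}.
Proof. by move=> a b; apply: bopP => x; exact: scalerDl. Qed.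
HB.instance Definition _ :=
  GRing.Zmodule_isLmodule.Build R[i] 'B(H) bop_scaleA bop_scale1 bop_scaleDr bop_scaleDl.

Lemma bop0E x : (0 : 'B(H)) x = 0. Proof. by []. Qed.
Lemma bopDE S T x : (S + T) x = S x + T x. Proof. by []. Qed.
Lemma bopNE T x : (- T) x = - T x. Proof. exact: scaleN1r. Qed.
Lemma bopZE a T x : (a *: T) x = a *: T x. Proof. by []. Qed.
Lemma bop1E x : (1 : 'B(H)) x = x. Proof. by []. Qed.
Lemma bopME S T x : (S * T) x = S (T x). Proof. by []. Qed.

End BoundedOpAlgebra.

Section DirectSum.
Variables (R : realType) (n : nat) (H : hilbertType R).

Definition dsum : Type := {ffun 'I_n -> H}.

HB.instance Definition _ := GRing.Lmodule.copy dsum {ffun 'I_n -> H}.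

Definition dsum_inner (x y : dsum) : R[i] := \sum_i inner (x i) (y i).

Fact dsum_inner_bilinear : bilinear_for *%R (Num.conj \; *%R) dsum_inner.
Proof.
split=> [y a u v|x a u v] /=; rewrite /dsum_inner mulr_sumr -big_split/=;
  apply: eq_bigr => i _; rewrite !ffunE.
- by rewrite (linearPl inner).
- by rewrite (linearPr inner).
Qed.
HB.instance Definition _ := bilinear_isBilinear.Build R[i] dsum dsum R[i]
  *%R (Num.conj \; *%R) dsum_inner dsum_inner_bilinear.

Fact dsum_inner_hermitian x y :
  dsum_inner x y = (-1) ^+ false * Num.conj (dsum_inner y x).
Proof.
rewrite expr0 mul1r rmorph_sum; apply: eq_bigr => i _.
by rewrite (hermC inner) expr0 mul1r.
Qed.
HB.instance Definition _ := isHermitianSesquilinear.Build R[i] dsum false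
  Num.conj dsum_inner dsum_inner_hermitian.

Fact dsum_inner_gt0 x : x != 0 -> 0 < dsum_inner x x.
Proof.
move=> x0; rewrite lt_def sumr_ge0 ?andbT => [|i _]; last exact: dnorm_ge0.
apply: contra_neq x0 => /eqP; rewrite psumr_eq0 => [|i _]; last exact: dnorm_ge0.
move=> /allP xx0; apply/ffunP => i; rewrite ffunE.
by apply/eqP; rewrite -(dnorm_eq0 inner); exact: (xx0 i (mem_index_enum i)).
Qed.
HB.instance Definition _ := isDotProduct.Build R[i] dsum dsum_inner
  dsum_inner_gt0.

Definition dsum_norm (x : dsum) : R[i] := sqrtC (dsum_inner x x).

Fact dsum_norm_triangle x y : dsum_norm (x + y) <= dsum_norm x + dsum_norm y.
Proof. exact: dot_triangle. Qed.

Fact dsum_normZ a x : dsum_norm (a *: x) = `|a| * dsum_norm x.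
Proof.
rewrite /dsum_norm dnormZ sqrtCM ?nnegrE ?exprn_ge0 ?dnorm_ge0//.
by rewrite sqrCK.
Qed.

Fact dsum_norm_eq0 x : dsum_norm x = 0 -> x = 0.
Proof. by move/eqP; rewrite sqrt_dnorm_eq0 => /eqP. Qed.

HB.instance Definition _ := Lmodule_isNormed.Build R[i] dsum
  dsum_norm_triangle dsum_normZ dsum_norm_eq0.

Lemma dsum_normE (x : dsum) : `|x| = sqrtC (\sum_i `|x i| ^+ 2).
Proof.
by rewrite /Num.norm/= /dsum_norm; congr sqrtC; apply: eq_bigr => i _;
  rewrite inner_normE.
Qed.

Lemma dsum_norm_comp (x : dsum) i : `|x i| <= `|x|.
Proof.
have sq_ge0 (P : pred 'I_n) : 0 <= \sum_(j | P j) `|x j| ^+ 2.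
  by apply: sumr_ge0 => j _; rewrite exprn_ge0.
rewrite dsum_normE -(@sqrCK _ `|x i|)// ler_sqrtC ?nnegrE ?exprn_ge0//.
by rewrite (bigD1 i)//= lerDl sq_ge0.
Qed.

Lemma dsum_norm_lt (x : dsum) (e : R[i]) : 0 < e ->
  (forall i, `|x i| < e / n.+1%:R) -> `|x| < e.
Proof.
move=> e0 xe; rewrite dsum_normE -(sqrCK (ltW e0)).
have sq_ge0 : 0 <= \sum_i `|x i| ^+ 2.
  by apply: sumr_ge0 => i _; rewrite exprn_ge0.
rewrite ltr_sqrtC ?nnegrE ?exprn_ge0 ?(ltW e0)//.
apply: (@le_lt_trans _ _ (\sum_(i < n) (e / n.+1%:R) ^+ 2)).
  by apply: ler_sum => i _; rewrite lerXn2r ?nnegrE ?divr_ge0// ltW.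
rewrite sumr_const card_ord -[ltLHS]mulr_natr exprMn -mulrA gtr_pMr ?exprn_gt0//.
rewrite exprVn mulrC ltr_pdivrMr ?exprn_gt0// mul1r -natrX ltr_nat.
by rewrite (leq_trans (ltnSn n))// -{1}(expn1 n.+1) leq_pexp2l.
Qed.

Lemma dsum_cvg (T : Type) (F : set_system T) (FF : Filter F)
    (f : T -> dsum) (l : dsum) :
  (forall i, f x i @[x --> F] --> l i) -> f @ F --> l.
Proof.
move=> fl; apply/cvgrPdist_lt => e e0.
have : \forall x \near F, forall i, `|l i - f x i| < e / n.+1%:R.
  apply: filter_forall => i.
  by move/cvgrPdist_lt : (fl i); apply; rewrite divr_gt0.
apply: filterS => x lx; apply: dsum_norm_lt => // i.
by rewrite !ffunE; exact: lx.
Qed.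

Lemma dsum_proj_continuous i : continuous (fun x : dsum => x i).
Proof.
move=> x; apply/(@cvgrPdist_lt _ _ _ (nbhs x)) => e e0.
have := nbhsx_ballx x e e0; apply: filterS => y; rewrite -ball_normE /=.
apply: le_lt_trans.
by have := dsum_norm_comp (x - y) i; rewrite !ffunE.
Qed.

Fact dsum_complete (F : set_system dsum) : ProperFilter F -> cauchy F -> cvg F.
Proof.
move=> FF /cauchy_ballP cF.
have cFi i : cvg ((fun x : dsum => x i) @ F).
  apply: cauchy_cvg; apply/cauchy_ballP => e e0.
  have := cF e e0.
  move=> [[A B] /= [FA FB] AB].
  exists ((fun x : dsum => x i) @` A, (fun x : dsum => x i) @` B) => /=.
    by split; [apply: filterS FA|apply: filterS FB] => x Ax /=; exists x.
  move=> [_ _] /= [[x Ax <-] [y By <-]].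
  have /= := AB (x, y) (conj Ax By); rewrite -!ball_normE /=; apply: le_lt_trans.
  by have := dsum_norm_comp (x - y) i; rewrite !ffunE.
apply/cvg_ex; exists [ffun i => lim ((fun x : dsum => x i) @ F)].
apply: (@dsum_cvg _ F _ id) => i; rewrite ffunE.
exact: cFi.
Qed.
HB.instance Definition _ := Uniform_isComplete.Build dsum dsum_complete.

Fact dsum_inner_normE (x : dsum) : dsum_inner x x = `|x| ^+ 2.
Proof. by rewrite sqrtCK. Qed.
HB.instance Definition _ := CompleteNormedModule_isHilbert.Build R dsum
  dsum_inner_normE.

End DirectSum.

Section OperatorMatrix.
Variables (R : realType) (n : nat) (H : hilbertType R).
Implicit Type A : 'M['B(H)]_n.

Definition opmx_fun A (x : dsum n H) : dsum n H :=
  [ffun i => \sum_j A i j (x j)].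

Fact opmx_linear A : linear (opmx_fun A).
Proof.
move=> a x y; apply/ffunP => i; rewrite !ffunE scaler_sumr -big_split/=.
by apply: eq_bigr => j _; rewrite !ffunE linearP.
Qed.

Fact opmx_continuous A : continuous (opmx_fun A).
Proof.
move=> x; apply: (@dsum_cvg _ _ _ _ (nbhs x)) => i.
rewrite [X in _ --> X]ffunE; under eq_cvg do rewrite ffunE.
apply: cvg_big => [|j _]; first exact: add_continuous.
have : {for x, continuous (A i j \o (fun y : dsum n H => y j))}.
  apply: continuous_comp; first exact: dsum_proj_continuous.
  exact: cts_fun.
exact.
Qed.

Definition opmx A : 'B(dsum n H) := mkbop (opmx_linear A) (@opmx_continuous A).

End OperatorMatrix.

Section Operators.
Variables (R : realType) (H : hilbertType R).
Implicit Types (S T : 'B(H)) (f : R -> R) (p : {poly R}).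

Definition opnorm T : R :=
  sup [set complex.Re `|T x| | x in [set x : H | `|x| = 1]].

(* The default value 0 of [xget] is never reached: adjoints exist by the Riesz
   representation theorem. *)
Definition adjoint T : 'B(H) :=
  xget 0 [set S : 'B(H) | forall x y, inner (T x) y = inner x (S y)].

(* On [R[i]] the order [0 <= z] also says that [z] is real. *)
Definition positive_op T : Prop := forall x, 0 <= inner (T x) x.

(* [|T| = (T^* T)^(1/2)], the unique positive square root of [T^* T]. *)
Definition absop T : 'B(H) :=
  xget 0 [set S : 'B(H) | positive_op S /\ S * S = adjoint T * T].

Definition spectrum T : set R[i] :=
  [set z : R[i] | ~ exists S, S * (T - z *: (1 : 'B(H))) = 1 /\ (T - z *: (1 : 'B(H))) * S = 1].

Definition horner_op p T : 'B(H) := \sum_(i < size p) (p`_i)%:C *: T ^+ i.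

(* Continuous functional calculus of a real function at a self-adjoint
   operator (whose spectrum is real): [f(T)] is the norm limit of [p_k(T)],
   where the polynomials [p_k] converge to [f] uniformly on the spectrum
   of [T]. *)
Definition is_funcalc f T S : Prop :=
  exists p : nat -> {poly R},
    {uniform [set t | spectrum T t%:C],
      (fun k t => (p k).[t]) @ \oo --> f} /\
    opnorm (horner_op (p k) T - S) @[k --> \oo] --> 0.

Definition funcalc f T : 'B(H) := xget 0 (is_funcalc f T).

End Operators.

Section Tuples.
Variables (R : realType) (d : nat).

Definition optuple (H : hilbertType R) : Type := 'I_d -> 'B(H).

(* If [H] is trivial the supremum is over the empty set, and is then 0. *)
Definition euclidean_radius (H : hilbertType R) (T : optuple H) : R :=
  sup [set Num.sqrt (\sum_k Normc.normc (inner (T k x) x) ^+ 2) |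
       x in [set x : H | `|x| = 1]].

Variable H : hilbertType R.
Implicit Types (S T : optuple H) (f : R -> R).

Definition tuple_adjoint T : optuple H := fun k => adjoint (T k).

Definition tuple_abs T : optuple H := fun k => absop (T k).

Definition tuple_add S T : optuple H := fun k => S k + T k.

Definition tuple_funcalc_sqr f T : optuple H := fun k => funcalc f (T k) ^+ 2.

Definition tuple_opmx n (A : 'M[optuple H]_n) : optuple (dsum n H) :=
  fun k => opmx (\matrix_(i, j) A i j k).

End Tuples.

(* The norm is the Euclidean one, hence spelled out: the library's norm on
   ['cV_n] is the supremum norm. *)
Definition numerical_radius (R : realType) n (M : 'M[R[i]]_n) : R :=
  sup [set Normc.normc (\sum_i (M *m x) i 0 * (x i 0)^*) |
       x in [set x : 'cV[R[i]]_n | \sum_i `|x i 0| ^+ 2 = 1]].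

(* Main.v *)
Require Import Defs.
From HB Require Import structures.
From mathcomp Require Import all_boot all_order all_algebra.
From mathcomp Require Import ring lra sesquilinear complex.
From mathcomp Require Import all_classical all_reals all_analysis.

(** Why the inequality holds. For a unit vector [X = (x_1, ..., x_n)] the [k]-th
    quadratic form of the operator matrix is the sum over [i, j] of
    [<A_ij^k x_j, x_i>]. The terms [(i, j)] and [(j, i)] are grouped together
    ([sum_upper]) and Minkowski's inequality over [k] ([l2_sum]) reduces the
    problem to bounding each group by [a_ij |x_i| |x_j|]; the resulting sum is
    the quadratic form of the matrix [(a_ij)] at the real unit vector
    [(|x_1|, ..., |x_n|)], hence at most its numerical radius. Diagonal groups are
    bounded by the definition of the Euclidean radius. Off-diagonal ones
    ([off_diagonal_bound]) follow from the mixed Schwarz inequality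
      [|<T x, y>| <= |f(|T|) x| |g(|T^*|) y|]  ([mixed_schwarz])
    and two applications of the Cauchy-Schwarz inequality.

    Most of the work goes into giving the adjoint, the absolute value and the
    functional calculus their properties.
    - Minimising a coercive quadratic energy ([energy_minimizer]) yields Riesz
      representation, hence adjoints, and the invertibility of coercive
      self-adjoint operators, hence information on spectra.
    - For a self-adjoint [A] and a real polynomial [p], the norm of [p(A)] is at
      most the supremum of [|p|] over the spectrum ([horner_op_bound]): otherwise
      [N^2 - p^2], where [N] is this norm, has no root in the spectrum, so that
      [N^2 - p(A)^2] is invertible, which contradicts the definition of [N].
    - With Weierstrass' theorem, proved by Bernstein polynomials, this makes
      [f(A)] well defined for positive [A] and continuous [f], multiplicative in
      [f] ([calculus_mul]) and compatible with intertwiners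
      ([calculus_intertwine]). Square roots of positive operators are instances.
    - The mixed Schwarz inequality is usually deduced from the polar
      decomposition. Here contractions [T r(|T|)] with [r] a polynomial
      approximate the polar factor ([approx_polar]). *)

Set Implicit Arguments.
Unset Strict Implicit.
Unset Printing Implicit Defensive.

Import Order.TTheory GRing.Theory Num.Theory.
Import numFieldNormedType.Exports.

Local Open Scope classical_set_scope.
Local Open Scope ring_scope.
Local Open Scope complex_scope.

(** * Polynomial approximation *)

Section Bernstein.
Variable R : realType.
Implicit Types (u v : nat -> R) (n : nat) (t : R).

(** The Bernstein polynomial of degree [n] of the sequence [u], that is the
    expected value of [u k] when [k] counts the successes in [n] independent
    trials of probability ['X]. Conditioning on the first trial gives this
    recursion, and the properties below follow by induction on it. *)
Fixpoint bernstein n u : {poly R} :=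
  if n is m.+1 then
    'X * bernstein m (fun k => u k.+1) + (1 - 'X) * bernstein m u
  else (u 0)%:P.

Lemma bernsteinS n u t : (bernstein n.+1 u).[t] =
  t * (bernstein n (fun k => u k.+1)).[t] + (1 - t) * (bernstein n u).[t].
Proof. by rewrite /= !hornerE. Qed.

Lemma bernstein_le n u v t : 0 <= t <= 1 ->
  (forall k, (k <= n)%N -> u k <= v k) ->
  (bernstein n u).[t] <= (bernstein n v).[t].
Proof.
move=> /andP[t0 t1]; elim: n u v => [|n IHn] u v uv.
  by rewrite /= !hornerE uv.
rewrite !bernsteinS lerD// ler_wpM2l ?subr_ge0//; apply: IHn => k kn.
  exact: uv.
by rewrite uv// leqW.
Qed.

Lemma bernstein_lin n a b u v t :
  (bernstein n (fun k => a * u k + b * v k)).[t] =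
  a * (bernstein n u).[t] + b * (bernstein n v).[t].
Proof.
elim: n u v => [|n IHn] u v; first by rewrite /= !hornerE.
by rewrite !bernsteinS !IHn; ring.
Qed.

Lemma bernstein_cst n c t : (bernstein n (fun=> c)).[t] = c.
Proof.
elim: n => [|n IHn]; first by rewrite /= hornerE.
by rewrite bernsteinS !IHn; ring.
Qed.

(** Second moment of the binomial law; at [a = - n t] it is its variance. *)
Lemma bernstein_sqr n a t : (bernstein n (fun k => (k%:R + a) ^+ 2)).[t] =
  (n%:R * t + a) ^+ 2 + n%:R * t * (1 - t).
Proof.
elim: n a => [|n IHn] a; first by rewrite /= !hornerE; ring.
rewrite bernsteinS IHn.
have -> : (fun k => (k.+1%:R + a) ^+ 2) = (fun k => (k%:R + (a + 1)) ^+ 2).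
  by apply/funext => k; rewrite -natr1; ring.
by rewrite IHn -natr1; ring.
Qed.

End Bernstein.

Section Weierstrass.
Variables (R : realType) (f : R -> R) (M : R).
Hypotheses (M_gt0 : 0 < M) (cf : {within `[0, M], continuous f}).

Lemma segment_bounded : exists K, forall t, 0 <= t <= M -> `|f t| <= K.
Proof.
have /compact_bounded [K [_ Kf]] :=
  continuous_compact cf (@segment_compact _ 0 M).
exists (K + 1) => t tM; apply: (Kf (K + 1)); first by rewrite ltrDl.
by exists t => //=; rewrite in_itv.
Qed.

(** Near the diagonal uniform continuity gives [e]; away from it the quadratic
    term dominates twice the supremum of [`|f|]. Compactness makes one [C] work
    everywhere. *)
Lemma quadratic_modulus (e : R) : 0 < e -> exists2 C : R, 0 <= C &
  forall s t, 0 <= s <= M -> 0 <= t <= M -> `|f s - f t| <= e + C * (s - t) ^+ 2.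
Proof.
move=> e0.
have [K fK] := segment_bounded.
pose P (C : R) s := 0 <= s <= M ->
  forall t, 0 <= t <= M -> `|f s - f t| <= e + C * (s - t) ^+ 2.
have /compact_near_coveringP/(_ _ (@pinfty_nbhs R) P) := @segment_compact R 0 M.
case=> [|B [_ HB]].
  move=> s0 /=; rewrite in_itv/= => s0M.
  have /subspace_continuousP/(_ s0) := cf; rewrite /= in_itv/= => /(_ s0M).
  move=> /cvgrPdist_lt/(_ (e / 2)); rewrite divr_gt0// => /(_ isT).
  rewrite near_withinE => /nbhs_ballP[d /= d0 Hd].
  have d20 : 0 < d / 2 by rewrite divr_gt0.
  exists (ball s0 (d / 2), [set C | 8 * K / d ^+ 2 < C]).
    split; first exact: nbhsx_ballx.
    by exists (8 * K / d ^+ 2); split => //; exact: num_real.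
  move=> [s C] /= [sd HC] sM t tM.
  have K0 : 0 <= K by apply: le_trans (fK s0 s0M).
  have C0 : 0 <= C by apply: ltW; apply: le_lt_trans HC; rewrite divr_ge0 ?sqr_ge0 ?mulr_ge0.
  have [std|std] := ltP `|s - t| (d / 2).
    have fs : `|f s0 - f s| < e / 2.
      apply: Hd => /=; last by rewrite in_itv.
      by move: sd; rewrite -!ball_normE/= => /lt_trans; apply; lra.
    have ft : `|f s0 - f t| < e / 2.
      apply: Hd => /=; last by rewrite in_itv.
      move: sd; rewrite -!ball_normE/= => sd.
      by rewrite -(subrKA s) (le_lt_trans (ler_normD _ _))//; lra.
    have : `|f s - f t| < e.
      rewrite -(subrKA (f s0)) (le_lt_trans (ler_normD _ _))//.
      by rewrite (distrC (f s)); lra.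
    by move=> /ltW/le_trans; apply; rewrite lerDl mulr_ge0// sqr_ge0.
  have h1 : `|f s - f t| <= 2 * K.
    by rewrite (le_trans (ler_normB _ _))//; have := fK s sM; have := fK t tM; lra.
  apply: (le_trans h1); apply: (@le_trans _ _ (C * (d / 2) ^+ 2)).
    have : 8 * K < C * d ^+ 2 by rewrite -ltr_pdivrMr ?exprn_gt0.
    by rewrite expr_div_n; lra.
  apply: ler_wpDl; first exact: ltW.
  by rewrite ler_wpM2l// -[leRHS]real_normK ?num_real// lerXn2r// nnegrE ?ltW.
exists (`|B| + 1); first by rewrite addr_ge0.
move=> s t sM tM; apply: (HB (`|B| + 1)) => //=.
  by rewrite (le_lt_trans (ler_norm _))// ltrDl.
Qed.

(** Weierstrass' theorem. A quadratic modulus of continuity turns the variance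
    of the Bernstein weights into the error bound. *)
Lemma weierstrass (e : R) : 0 < e ->
  exists p : {poly R}, forall t, 0 <= t <= M -> `|p.[t] - f t| <= e.
Proof.
move=> e0; have e20 : 0 < e / 2 by rewrite divr_gt0.
have [C C0 fC] := quadratic_modulus e20.
have [n nC] : exists n : nat, C * M ^+ 2 / (e / 2) < n.+1%:R.
  by exists (Num.truncn (C * M ^+ 2 / (e / 2))); rewrite truncnS_gt.
pose u (k : nat) : R := f (k%:R * M / n.+1%:R).
(* ['X] is rescaled from [[0, M]] to [[0, 1]]. *)
exists (bernstein n.+1 u \Po (M^-1 *: 'X)) => t tM.
rewrite horner_comp hornerZ hornerX; set s := M^-1 * t.
have n0 : 0 < n.+1%:R :> R by rewrite ltr0n.
have s01 : 0 <= s <= 1.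
  case/andP: tM => t0 tM; rewrite /s mulr_ge0 ?invr_ge0 ?(ltW M_gt0)//=.
  by rewrite ler_pdivrMl// mulr1.
have ts : t = M * s by rewrite /s mulrA divff ?mul1r// gt_eqF.
pose a := - (n.+1%:R * s).
pose c := C * (M / n.+1%:R) ^+ 2.
have bound k : (k <= n.+1)%N -> `|u k - f t| <= e / 2 + c * (k%:R + a) ^+ 2.
  move=> kn; have := fC (k%:R * M / n.+1%:R) t.
  rewrite !mulr_ge0 ?invr_ge0 ?(ltW n0) ?(ltW M_gt0)//= mulrAC.
  rewrite ler_piMl ?(ltW M_gt0) ?ler_pdivrMr ?mul1r ?ler_nat// => /(_ isT tM).
  rewrite -/(u k) [_ / _ * M]mulrAC -/(u k).
  have -> : k%:R * M / n.+1%:R - t = M / n.+1%:R * (k%:R + a).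
    by rewrite ts /a; field; rewrite addrC natr1 gt_eqF.
  by rewrite exprMn mulrA.
have E2 : (bernstein n.+1 (fun k => (k%:R + a) ^+ 2)).[s] = n.+1%:R * s * (1 - s).
  by rewrite bernstein_sqr /a subrr expr0n add0r.
have var : c * (n.+1%:R * s * (1 - s)) <= e / 2.
  have s1 : s * (1 - s) <= 1 by move: s01 => /andP[? ?]; nra.
  have -> : c * (n.+1%:R * s * (1 - s)) = C * M ^+ 2 / n.+1%:R * (s * (1 - s)).
    by rewrite /c; field; rewrite addrC natr1 gt_eqF.
  apply: (@le_trans _ _ (C * M ^+ 2 / n.+1%:R)).
    by rewrite ler_piMr// divr_ge0 ?(ltW n0)// mulr_ge0 ?sqr_ge0.
  by rewrite ler_pdivrMr// [leRHS]mulrC -ler_pdivrMr// ltW.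
have up : (bernstein n.+1 u).[s] <= f t + e / 2 + c * (n.+1%:R * s * (1 - s)).
  rewrite -E2.
  have := @bernstein_lin _ n.+1 1 c (fun=> f t + e / 2) (fun k => (k%:R + a) ^+ 2) s.
  rewrite bernstein_cst mul1r => <-; apply: bernstein_le => // k kn.
  by have := bound k kn; rewrite ler_norml => /andP[_]; lra.
have dn : f t - e / 2 - c * (n.+1%:R * s * (1 - s)) <= (bernstein n.+1 u).[s].
  rewrite -E2.
  have := @bernstein_lin _ n.+1 1 (- c) (fun=> f t - e / 2) (fun k => (k%:R + a) ^+ 2) s.
  rewrite bernstein_cst mul1r mulNr => <-; apply: bernstein_le => // k kn.
  by have := bound k kn; rewrite ler_norml => /andP[]; lra.
by rewrite ler_norml; lra.
Qed.

End Weierstrass.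

(** * Real norms and inner products *)

Section Supremum.
Variables (R : realType) (E : set R).

Lemma sup_ge0 : (forall x, E x -> 0 <= x) -> 0 <= sup E.
Proof.
move=> E0; have [[[x Ex] ubE]|/sup_out ->//] := pselect (has_sup E).
by rewrite (le_trans (E0 x Ex))// ub_le_sup.
Qed.

Lemma sup_le_ge0 M : 0 <= M -> (forall x, E x -> x <= M) -> sup E <= M.
Proof.
move=> M0 EM; have [->|/set0P ne] := eqVneq E set0; first by rewrite sup0.
exact: ge_sup.
Qed.

End Supremum.

Section RealNorm.
Variables (R : realType) (H : hilbertType R).
Implicit Types (x y z : H) (a b : R[i]) (r : R).

(** The norm and inner product of [H] take values in [R[i]]; their real parts
    [nrm] and [rin] carry all the estimates, which thus take place in [R]. *)
Definition nrm x : R := complex.Re `|x|.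
Definition rin x y : R := complex.Re (inner x y).

Lemma norm_nrm x : `|x| = (nrm x)%:C.
Proof. by rewrite RRe_real// normr_real. Qed.

Lemma nrm_ge0 x : 0 <= nrm x.
Proof. by rewrite -lecR -norm_nrm normr_ge0. Qed.

Lemma nrm0 : nrm 0 = 0.
Proof. by rewrite /nrm normr0. Qed.

Lemma nrm_eq0 x : nrm x = 0 -> x = 0.
Proof. by move=> x0; apply/normr0_eq0; rewrite norm_nrm x0. Qed.

Lemma nrmD x y : nrm (x + y) <= nrm x + nrm y.
Proof. by rewrite -lecR rmorphD/= -!norm_nrm ler_normD. Qed.

Lemma nrmN x : nrm (- x) = nrm x.
Proof. by rewrite /nrm normrN. Qed.

Lemma nrmBC x y : nrm (x - y) = nrm (y - x).
Proof. by rewrite -nrmN opprB. Qed.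

Lemma nrmB x y z : nrm (x - y) <= nrm (x - z) + nrm (z - y).
Proof. by rewrite -[x - y](subrKA z) nrmD. Qed.

Lemma norm_normc a : `|a| = (Normc.normc a)%:C.
Proof. by []. Qed.

Lemma normc_ge0 a : 0 <= Normc.normc a.
Proof. by rewrite -lecR -norm_normc normr_ge0. Qed.

Lemma normcR r : Normc.normc r%:C = `|r|.
Proof. by rewrite /Normc.normc/= expr0n addr0 sqrtr_sqr. Qed.

Lemma nrmZ a x : nrm (a *: x) = Normc.normc a * nrm x.
Proof. by apply: complexI; rewrite rmorphM/= -!norm_nrm normrZ. Qed.

Lemma nrmZR r x : nrm (r%:C *: x) = `|r| * nrm x.
Proof. by rewrite nrmZ normcR. Qed.

Lemma inner_nrm x : inner x x = (nrm x ^+ 2)%:C.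
Proof. by rewrite inner_normE norm_nrm rmorphXn. Qed.

Lemma nrm_sqr x : nrm x ^+ 2 = rin x x.
Proof. by rewrite /rin inner_nrm. Qed.

Lemma innerC x y : inner x y = (inner y x)^*.
Proof. by rewrite [LHS](hermC inner) expr0 mul1r. Qed.

Lemma innerDl x y z : inner (x + y) z = inner x z + inner y z.
Proof. by rewrite linearDl. Qed.
Lemma innerDr x y z : inner z (x + y) = inner z x + inner z y.
Proof. by rewrite linearDr. Qed.
Lemma innerNl x z : inner (- x) z = - inner x z.
Proof. by rewrite linearNl. Qed.
Lemma innerNr x z : inner z (- x) = - inner z x.
Proof. by rewrite linearNr. Qed.
Lemma innerBl x y z : inner (x - y) z = inner x z - inner y z.
Proof. by rewrite innerDl innerNl. Qed.
Lemma innerBr x y z : inner z (x - y) = inner z x - inner z y.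
Proof. by rewrite innerDr innerNr. Qed.
Lemma innerZl a x z : inner (a *: x) z = a * inner x z.
Proof. by rewrite linearZl_LR. Qed.
Lemma innerZr a x z : inner z (a *: x) = a^* * inner z x.
Proof. by rewrite linearZr_LR. Qed.
Lemma conjR r : Num.conj r%:C = r%:C.
Proof. exact: conjc_real. Qed.
Lemma innerZRr r x z : inner z (r%:C *: x) = r%:C * inner z x.
Proof. by rewrite innerZr conjR. Qed.
Lemma inner_suml n (u : 'I_n -> H) z : inner (\sum_i u i) z = \sum_i inner (u i) z.
Proof.
apply: (big_morph (fun x => inner x z)) => [x y|]; first exact: innerDl.
by rewrite linear0l.
Qed.

Lemma inner_CS x y : Normc.normc (inner x y) <= nrm x * nrm y.
Proof.
have := dot_CauchySchwarz inner x y.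
rewrite !inner_nrm norm_normc -rmorphXn -rmorphM lecR -exprMn.
by rewrite ler_sqr ?nnegrE ?mulr_ge0 ?nrm_ge0 ?normc_ge0.
Qed.

Lemma Re_normc a : `|complex.Re a| <= Normc.normc a.
Proof.
case: a => u v /=; rewrite -sqrtr_sqr ler_sqrt ?addr_ge0 ?sqr_ge0//.
by rewrite lerDl sqr_ge0.
Qed.

Lemma rin_CS x y : `|rin x y| <= nrm x * nrm y.
Proof. exact: le_trans (Re_normc _) (inner_CS _ _). Qed.

Lemma rinC x y : rin x y = rin y x.
Proof. by rewrite /rin innerC; case: (inner y x). Qed.

Lemma rinDl x y z : rin (x + y) z = rin x z + rin y z.
Proof. by rewrite /rin innerDl raddfD. Qed.
Lemma rinDr x y z : rin z (x + y) = rin z x + rin z y.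
Proof. by rewrite /rin innerDr raddfD. Qed.
Lemma rinNl x z : rin (- x) z = - rin x z.
Proof. by rewrite /rin innerNl raddfN. Qed.
Lemma rinNr x z : rin z (- x) = - rin z x.
Proof. by rewrite /rin innerNr raddfN. Qed.
Lemma rinZl r x z : rin (r%:C *: x) z = r * rin x z.
Proof. by rewrite /rin innerZl; case: (inner x z) => u v /=; rewrite mul0r subr0. Qed.
Lemma rinZr r x z : rin z (r%:C *: x) = r * rin z x.
Proof. by rewrite rinC rinZl rinC. Qed.

Definition rinE := (rinDl, rinDr, rinNl, rinNr, rinZl, rinZr).

Lemma inner_eq x y : (forall z, inner x z = inner y z) -> x = y.
Proof.
move=> xy; apply/subr0_eq/nrm_eq0/eqP; rewrite -sqrf_eq0 nrm_sqr /rin.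
by rewrite innerBl xy subrr.
Qed.

Lemma nrm_cvg (u : nat -> H) l :
  u @ \oo --> l <-> forall e, 0 < e -> \forall n \near \oo, nrm (u n - l) < e.
Proof.
split=> [/cvgrPdist_lt ul e e0|ul].
  have e0C : 0 < e%:C by rewrite ltcR.
  by apply: filterS (ul _ e0C) => n; rewrite norm_nrm ltcR nrmBC.
apply/cvgrPdist_lt => -[e e']; rewrite ltcE/= => /andP[/eqP -> e0].
by apply: filterS (ul e e0) => n; rewrite -[_ +i* _]/(e%:C) norm_nrm ltcR nrmBC.
Qed.

(** Completeness for sequences with a harmonic Cauchy modulus; the rate of
    convergence is kept because linearity and boundedness of pointwise limits of
    operators are derived from it. *)
Lemma nrm_complete (u : nat -> H) (b : R) : 0 <= b ->
  (forall m n, (m <= n)%N -> nrm (u m - u n) <= b / m.+1%:R) ->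
  exists l, forall n, nrm (u n - l) <= b / n.+1%:R.
Proof.
move=> b0 ub.
have small e : 0 < e -> exists N : nat, b / N.+1%:R < e.
  move=> e0; exists (Num.truncn (b / e)); rewrite ltr_pdivrMr ?ltr0n//.
  by rewrite mulrC -ltr_pdivrMr// truncnS_gt.
have /cvg_ex[l ul] : cvgn u.
  apply: cauchy_cvg; apply: cauchy_exP => -[e e'].
  rewrite ltcE/= => /andP[/eqP -> e0].
  have [N Ne] := small e e0; exists (u N); exists N => // n /= Nn.
  rewrite -ball_normE/= -[_ +i* _]/(e%:C) norm_nrm ltcR.
  by rewrite (le_lt_trans (ub _ _ Nn)).
exists l => n; apply/ler_addgt0Pr => e e0.
have /nrm_cvg/(_ _ e0)[N _ Nl] := ul.
rewrite (le_trans (nrmB _ _ (u (n + N)%N)))// lerD ?ub ?leq_addr//.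
by apply/ltW/Nl => /=; rewrite leq_addl.
Qed.

End RealNorm.

(** * Bounded operators *)

Section Bounded.
Variables (R : realType) (H : hilbertType R).
Implicit Types (S T : 'B(H)) (x y z h : H) (a : R[i]).

Definition bounded_by (M : R) T := forall x, nrm (T x) <= M * nrm x.

Lemma bopBE S T x : (S - T) x = S x - T x.
Proof. by rewrite bopDE bopNE. Qed.

Lemma opD T x y : T (x + y) = T x + T y. Proof. exact: linearD. Qed.
Lemma opB T x y : T (x - y) = T x - T y. Proof. exact: linearB. Qed.
Lemma opN T x : T (- x) = - T x. Proof. exact: linearN. Qed.
Lemma opZ T a x : T (a *: x) = a *: T x. Proof. exact: linearZ. Qed.

Lemma op_bounded T : exists2 M, 0 <= M & bounded_by M T.
Proof.
have /linear_boundedP/pinfty_ex_gt0[M M0 HM] : bounded_near T (nbhs 0).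
  by apply: continuous_linear_bounded; exact: cts_fun.
move: M M0 HM => [M M']; rewrite ltcE/= => /andP[/eqP -> M0] HM.
exists M; first exact: ltW.
by move=> x; rewrite -lecR rmorphM/= -!norm_nrm HM.
Qed.

Lemma bounded_op_exists (f : H -> H) (K : R) : linear f ->
  (forall x, nrm (f x) <= K * nrm x) -> exists T, T =1 f.
Proof.
move=> lf fK.
pose g : {linear H -> H} := HB.pack f (@GRing.isLinear.Build R[i] H H *:%R f lf).
have cf : continuous f.
  apply: (@bounded_linear_continuous _ _ _ g); apply/linear_boundedP.
  exists (`|K|%:C); split; first by rewrite complex_real.
  move=> [r r']; rewrite ltcE/= => /andP[/eqP -> Kr] x.
  rewrite -[_ +i* _]/(r%:C) !norm_nrm -rmorphM lecR (le_trans (fK x))//.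
  by rewrite ler_wpM2r ?nrm_ge0// (le_trans (ler_norm _))// ltW.
by exists (mkbop lf cf).
Qed.

Lemma opnorm_ub T : has_ubound [set complex.Re `|T x| | x in [set x : H | `|x| = 1]].
Proof.
have [M M0 TM] := op_bounded T; exists M => _ [x /= x1 <-].
by rewrite -/(nrm (T x)) (le_trans (TM x))// /nrm x1 mulr1.
Qed.

Lemma nrm_unit x : nrm x != 0 -> `|(nrm x)^-1%:C *: x| = 1.
Proof.
move=> x0; rewrite norm_nrm nrmZR ger0_norm ?invr_ge0 ?nrm_ge0//.
by rewrite mulVf.
Qed.

Lemma nrm_opnorm T : bounded_by (opnorm T) T.
Proof.
move=> x; have [x0|x0] := eqVneq (nrm x) 0.
  by rewrite (nrm_eq0 x0) linear0 nrm0 mulr0.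
rewrite -ler_pdivrMr ?lt_def ?x0 ?nrm_ge0//.
apply: ub_le_sup; first exact: opnorm_ub.
exists ((nrm x)^-1%:C *: x); first exact: nrm_unit.
by rewrite linearZ -/(nrm _) nrmZR ger0_norm ?invr_ge0 ?nrm_ge0 1?mulrC.
Qed.

Lemma opnorm_ge0 T : 0 <= opnorm T.
Proof. by apply: sup_ge0 => _ [x _ <-]; exact: nrm_ge0. Qed.

Lemma opnorm_le T M : 0 <= M -> bounded_by M T -> opnorm T <= M.
Proof.
move=> M0 TM; apply: sup_le_ge0 => // _ [x /= x1 <-].
by rewrite -/(nrm (T x)) (le_trans (TM x))// /nrm x1 mulr1.
Qed.

End Bounded.

Section Variational.
Variables (R : realType) (H : hilbertType R).
Implicit Types (S T : 'B(H)) (x y z h : H) (a : R[i]).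

Definition selfadj T := forall x y, inner (T x) y = inner x (T y).

Definition invertible T := exists S, S * T = 1 /\ T * S = 1.

Lemma rin_inj x y : (forall h, rin x h = rin y h) -> x = y.
Proof.
move=> xy; apply/subr0_eq/nrm_eq0/eqP; rewrite -sqrf_eq0 nrm_sqr.
by rewrite rinDl rinNl xy subrr.
Qed.

Lemma selfadj_rin T x y : selfadj T -> rin (T x) y = rin x (T y).
Proof. by move=> sT; rewrite /rin sT. Qed.

(** The minimiser of the energy [rin (S x) x - 2 phi x] solves [S x = phi]
    weakly. A minimising sequence is Cauchy by the parallelogram identity and
    coercivity. The identity operator gives Riesz representation, a general
    [S] gives invertibility. *)
Lemma energy_minimizer S (c K : R) (phi : H -> R) : selfadj S -> 0 < c -> 0 <= K ->
    (forall x, c * nrm x ^+ 2 <= rin (S x) x) ->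
    (forall x y, phi (x + y) = phi x + phi y) ->
    (forall (r : R) x, phi (r%:C *: x) = r * phi x) ->
    (forall x, `|phi x| <= K * nrm x) ->
  exists x, forall h, rin (S x) h = phi h.
Proof.
move=> sS c0 K0 coer phiD phiZ phiK.
pose J x := rin (S x) x - 2 * phi x.
have JD x h (t : R) : J (x + t%:C *: h) =
    J x + 2 * t * (rin (S x) h - phi h) + t ^+ 2 * rin (S h) h.
  rewrite /J linearD linearZ /= !rinE phiD phiZ (selfadj_rin h x sS).
  by rewrite (rinC h); ring.
have Jlb : has_lbound (range J).
  exists (- (K ^+ 2 / c)) => _ [x _ <-]; rewrite /J.
  have h1 := coer x; have := phiK x; rewrite ler_norml => /andP[_ h2].
  have h3 : 0 <= (c * nrm x - K) ^+ 2 / c by rewrite divr_ge0 ?sqr_ge0// ltW.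
  have h4 : (c * nrm x - K) ^+ 2 / c = c * nrm x ^+ 2 - 2 * (K * nrm x) + K ^+ 2 / c.
    by field; rewrite gt_eqF.
  by lra.
pose m := inf (range J).
have Jm x : m <= J x by apply: ge_inf => //; exists x.
have eps n : 0 < (n.+1%:R ^- 2 : R) by rewrite invr_gt0 exprn_gt0.
have [u uJ] : exists u : nat -> H, forall n, J (u n) < m + n.+1%:R ^- 2.
  suff /choice[u] : forall n, exists x, J x < m + n.+1%:R ^- 2 by exists u.
  move=> n; have [|_ [x _ <-] xm] := @inf_adherent _ (range J) _ (eps n).
  - by split => //; exists (J 0); exists 0.
  by exists x.
have cauchy i j : (i <= j)%N -> nrm (u i - u j) <= (2 / Num.sqrt c) / i.+1%:R.
  move=> ij.
  (* Parallelogram identity at the midpoint of [u i] and [u j]. *)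
  have half : J (u j + (2^-1)%:C *: (u i - u j)) =
      2^-1 * J (u i) + 2^-1 * J (u j) - 4^-1 * rin (S (u i - u j)) (u i - u j).
    have := JD (u j) (u i - u j) 1; rewrite scale1r subrKC JD => ->.
    by field.
  have ji : (j.+1%:R ^- 2 : R) <= i.+1%:R ^- 2.
    by rewrite lef_pV2 ?posrE ?exprn_gt0// lerXn2r ?nnegrE// ler_nat.
  have h1 := Jm (u j + (2^-1)%:C *: (u i - u j)).
  have h2 := coer (u i - u j); have h3 := uJ i; have h4 := uJ j.
  have h5 : c * nrm (u i - u j) ^+ 2 <= 4 * i.+1%:R ^- 2.
    rewrite half in h1; move: (i.+1%:R ^- 2) (j.+1%:R ^- 2) ji h3 h4 => di dj.
    by lra.
  rewrite -ler_sqr ?nnegrE ?nrm_ge0 ?divr_ge0 ?sqrtr_ge0//.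
  rewrite !expr_div_n sqr_sqrtr ?(ltW c0)// mulrAC ler_pdivlMr// mulrC.
  by rewrite (le_trans h5)// -[2 ^+ 2]natrX.
have [|x ux] := nrm_complete _ cauchy; first by rewrite divr_ge0 ?sqrtr_ge0.
exists x => h.
have [M M0 SM] := op_bounded S.
pose C := (1 + rin (S h) h) / 2 + M * (2 / Num.sqrt c) * nrm h.
have small n : `|rin (S x) h - phi h| <= C / n.+1%:R.
  have n0 : 0 < n.+1%:R^-1 :> R by rewrite invr_gt0.
  (* First order condition, tested with the steps [+- 1 / (n + 1)] because
     [u n] is minimising only up to [1 / (n + 1) ^ 2]. *)
  have D : `|rin (S (u n)) h - phi h| <= (1 + rin (S h) h) / 2 / n.+1%:R.
    have h1 := Jm (u n + (n.+1%:R^-1)%:C *: h).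
    have h2 := Jm (u n + (- n.+1%:R^-1)%:C *: h).
    have h3 := uJ n; rewrite -exprVn in h3; rewrite !JD in h1 h2.
    move: n.+1%:R^-1 n0 h1 h2 h3 => s s0 h1 h2 h3.
    rewrite ler_norml; apply/andP; split; rewrite -(ler_pM2l s0); lra.
  have E : `|rin (S (x - u n)) h| <= M * (2 / Num.sqrt c) * nrm h / n.+1%:R.
    rewrite (le_trans (rin_CS _ _))//.
    have := SM (x - u n); have := ux n; rewrite nrmBC => h1 h2.
    rewrite [leRHS]mulrAC ler_wpM2r ?nrm_ge0// (le_trans h2)// -mulrA.
    by rewrite ler_wpM2l.
  have -> : rin (S x) h - phi h = rin (S (u n)) h - phi h + rin (S (x - u n)) h.
    by rewrite linearB /= !rinE; ring.
  by rewrite (le_trans (ler_normD _ _))// /C mulrDl lerD.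
apply/eqP; rewrite -subr_eq0 -normr_le0; apply/ler_addgt0Pr => e e0.
rewrite add0r; apply: (le_trans (small (Num.truncn (C / e)))).
rewrite ler_pdivrMr// mulrC -ler_pdivrMr// ltW// truncnS_gt//.
Qed.

(** The energy only sees real parts; replacing [x] by ['i *: x] recovers the
    imaginary part. *)
Lemma riesz_inner (phi : H -> R[i]) (K : R) : scalar phi -> 0 <= K ->
  (forall x, Normc.normc (phi x) <= K * nrm x) ->
  exists y, forall x, phi x = inner x y.
Proof.
move=> lphi K0 phiK.
have phiD x y : phi (x + y) = phi x + phi y.
  by have := lphi 1 x y; rewrite scale1r mul1r.
have phi0 : phi 0 = 0 by apply: (@addrI _ (phi 0)); rewrite -phiD !addr0.
have phiZ a x : phi (a *: x) = a * phi x.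
  by have := lphi a x 0; rewrite addr0 phi0 addr0.
have sa1 : selfadj 1 by [].
have [|x y|r x|x|y Hy] :=
  @energy_minimizer 1 1 K (fun x => complex.Re (phi x)) sa1 ltr01 K0.
- by move=> x; rewrite mul1r nrm_sqr.
- by rewrite phiD raddfD.
- by rewrite phiZ; case: (phi x) => u v /=; rewrite mul0r subr0.
- exact: le_trans (Re_normc _) (phiK _).
exists y => x.
have E z : complex.Re (phi z) = complex.Re (inner z y).
  by rewrite -Hy bop1E -/(rin z y) rinC.
have := E ('i *: x); rewrite phiZ innerZl; have := E x.
case: (phi x) (inner x y) => [u v] [u' v'] /= ->.
by rewrite !mul0r !mul1r !sub0r => /oppr_inj ->.
Qed.

Lemma adjoint_spec T x y : inner (T x) y = inner x (adjoint T y).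
Proof.
suff [S HS] : exists S : 'B(H), forall x y, inner (T x) y = inner x (S y).
  exact: (@xgetI _ 0 [set S : 'B(H) | forall x y, inner (T x) y = inner x (S y)] S HS).
have [M M0 TM] := op_bounded T.
have /choice[s Hs] z : exists s, forall x, inner (T x) z = inner x s.
  apply: (@riesz_inner _ (M * nrm z)); last 2 first.
  - by rewrite mulr_ge0 ?nrm_ge0.
  - move=> u; rewrite (le_trans (inner_CS _ _))// mulrAC.
    by rewrite ler_wpM2r ?nrm_ge0.
  by move=> a u v; rewrite linearP innerDl innerZl.
have ls : linear s.
  move=> a u v; apply: inner_eq => w.
  rewrite innerDl innerZl !(innerC _ w) -!Hs innerDr innerZr.
  by rewrite rmorphD rmorphM/= conjcK.
have [|S HS] := @bounded_op_exists _ _ s M ls.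
  move=> u; have [->|su0] := eqVneq (nrm (s u)) 0.
    by rewrite mulr_ge0 ?nrm_ge0.
  rewrite -(@ler_pM2l _ (nrm (s u))) ?lt_def ?su0 ?nrm_ge0//.
  rewrite -expr2 nrm_sqr /rin -Hs (le_trans (ler_norm _))//.
  rewrite (le_trans (rin_CS _ _))// mulrA ler_wpM2r ?nrm_ge0// mulrC.
  exact: TM.
by exists S => u v; rewrite HS.
Qed.

Lemma adjoint_spec2 T x y : inner (adjoint T x) y = inner x (T y).
Proof. by rewrite innerC -adjoint_spec -innerC. Qed.

Lemma adjointK T : adjoint (adjoint T) = T.
Proof.
apply: bopP => x; apply: inner_eq => y.
by rewrite adjoint_spec2 -adjoint_spec.
Qed.

(** The energy minimiser for [rin y] is a preimage of [y]; coercivity bounds it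
    by [nrm y / c] and makes it unique, hence linear in [y]. *)
Lemma coercive_invertible S (c : R) : selfadj S -> 0 < c ->
  (forall x, c * nrm x ^+ 2 <= rin (S x) x) -> invertible S.
Proof.
move=> sS c0 coer.
have lb x : c * nrm x <= nrm (S x).
  have [->|x0] := eqVneq (nrm x) 0; first by rewrite mulr0 nrm_ge0.
  rewrite -(@ler_pM2r _ (nrm x)) ?lt_def ?x0 ?nrm_ge0// -mulrA -expr2.
  by rewrite (le_trans (coer x))// (le_trans (ler_norm _))// rin_CS.
have inj x y : S x = S y -> x = y.
  move=> xy; apply/subr0_eq/nrm_eq0/eqP; have := lb (x - y).
  rewrite linearB /= xy subrr nrm0 pmulr_rle0// => h.
  by rewrite eq_le h nrm_ge0.
have /choice[s Hs] y : exists x, S x = y.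
  have [x z|r x|x|x Hx] := energy_minimizer sS c0 (nrm_ge0 y) coer (phi := rin y).
  - by rewrite rinDr.
  - by rewrite rinZr.
  - exact: rin_CS.
  by exists x; apply: rin_inj.
have [|x|S' HS] := @bounded_op_exists _ _ s c^-1.
- by move=> a x y; apply: inj; rewrite linearP /= !Hs.
- by rewrite ler_pdivlMl// (le_trans (lb _))// Hs.
by exists S'; split; apply: bopP => x; rewrite bopME bop1E HS; [apply: inj|]; rewrite Hs.
Qed.

End Variational.

(** * Polynomials in a self-adjoint operator *)

Section PolynomialCalculus.
Variables (R : realType) (H : hilbertType R).
Implicit Types (S T : 'B(H)) (x y z : H) (a : R[i]) (p q : {poly R[i]}).

Lemma bop_scaleAl a S T : a *: (S * T) = (a *: S) * T.
Proof. exact: bopP. Qed.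

Lemma bop_scaleAr a S T : a *: (S * T) = S * (a *: T).
Proof. by apply: bopP => x; rewrite bopZE !bopME bopZE linearZ. Qed.

(** Evaluation with complex coefficients: real polynomials only split into
    linear factors over [R[i]]. *)
Definition opev p T : 'B(H) := \sum_(i < size p) p`_i *: T ^+ i.

Lemma opev_widen n p T : (size p <= n)%N ->
  opev p T = \sum_(i < n) p`_i *: T ^+ i.
Proof.
move=> pn; rewrite /opev (big_ord_widen n (fun i => p`_i *: T ^+ i))//.
rewrite big_mkcond; apply: eq_bigr => i _; case: ltnP => // pi.
by rewrite nth_default// scale0r.
Qed.

Lemma opevP a p q T : opev (a *: p + q) T = a *: opev p T + opev q T.
Proof.
pose n := maxn (size p) (size q).
have pn : (size p <= n)%N by rewrite leq_maxl.
have qn : (size q <= n)%N by rewrite leq_maxr.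
rewrite (@opev_widen n) ?(opev_widen T pn) ?(opev_widen T qn); last first.
  rewrite (leq_trans (size_polyD _ _))// geq_max qn andbT.
  exact: leq_trans (size_scale_leq _ _) pn.
rewrite scaler_sumr -big_split; apply: eq_bigr => i _ /=.
by rewrite coefD coefZ scalerDl scalerA.
Qed.

Lemma opev0 T : opev 0 T = 0.
Proof. by rewrite /opev size_poly0 big_ord0. Qed.

Lemma opevD p q T : opev (p + q) T = opev p T + opev q T.
Proof. by rewrite -[p]scale1r opevP !scale1r. Qed.

Lemma opevZ a p T : opev (a *: p) T = a *: opev p T.
Proof. by rewrite -[a *: p]addr0 opevP opev0 addr0. Qed.

Lemma opevB p q T : opev (p - q) T = opev p T - opev q T.
Proof. by rewrite opevD -scaleN1r opevZ scaleN1r. Qed.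

Lemma opevC a T : opev a%:P T = a *: (1 : 'B(H)).
Proof.
by rewrite (@opev_widen 1) ?size_polyC_leq1// big_ord1 coefC expr0.
Qed.

Lemma opevMX p T : opev (p * 'X) T = opev p T * T.
Proof.
rewrite (@opev_widen (size p).+1); last first.
  by rewrite (leq_trans (size_polyMleq _ _))// size_polyX addn2.
rewrite big_ord_recl coefMX/= scale0r add0r /opev mulr_suml.
by apply: eq_bigr => i _; rewrite coefMX/= -bop_scaleAl -exprSr.
Qed.

Lemma opevX T : opev 'X T = T.
Proof. by rewrite -['X]mul1r opevMX opevC scale1r mul1r. Qed.

Lemma opevM p q T : opev (p * q) T = opev p T * opev q T.
Proof.
elim/poly_ind: q => [|q c IHq]; first by rewrite mulr0 !opev0 mulr0.
rewrite mulrDr !opevD mulrA !opevMX IHq mulrDr -mulrA opevC; congr +%R.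
by rewrite mulrC mul_polyC opevZ -bop_scaleAr mulr1.
Qed.

End PolynomialCalculus.

Section RealPolynomials.
Variables (R : realType) (H : hilbertType R).
Implicit Types (S T A Q : 'B(H)) (x y z : H) (p q : {poly R}) (r : R).

Lemma horner_opE p T : horner_op p T = opev (map_poly (real_complex R) p) T.
Proof.
rewrite /opev size_map_poly; apply: eq_bigr => i _.
by rewrite coef_map.
Qed.

Lemma horner_opD p q T : horner_op (p + q) T = horner_op p T + horner_op q T.
Proof. by rewrite !horner_opE rmorphD opevD. Qed.

Lemma horner_opB p q T : horner_op (p - q) T = horner_op p T - horner_op q T.
Proof. by rewrite !horner_opE rmorphB opevB. Qed.

Lemma horner_opM p q T : horner_op (p * q) T = horner_op p T * horner_op q T.
Proof. by rewrite !horner_opE rmorphM opevM. Qed.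

Lemma horner_opC r T : horner_op r%:P T = r%:C *: (1 : 'B(H)).
Proof. by rewrite horner_opE map_polyC opevC. Qed.

Lemma horner_opX T : horner_op 'X T = T.
Proof. by rewrite horner_opE map_polyX opevX. Qed.

Lemma horner_op_comp p q T : horner_op (p \Po q) T = horner_op p (horner_op q T).
Proof.
elim/poly_ind: p => [|p c IHp].
  by rewrite comp_poly0 !horner_opE rmorph0 !opev0.
rewrite comp_polyD comp_polyM comp_polyX comp_polyC.
by rewrite !horner_opD !horner_opM IHp !horner_opC horner_opX.
Qed.

Lemma horner_op_intertwine S A T p : S * A = T * S ->
  S * horner_op p A = horner_op p T * S.
Proof.
move=> SA; elim/poly_ind: p => [|p c IHp].
  by rewrite !horner_opE !rmorph0 !opev0 mulr0 mul0r.
rewrite !horner_opD !horner_opM !horner_opC !horner_opX mulrDr mulrDl.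
by rewrite mulrA IHp -!mulrA SA -bop_scaleAr -bop_scaleAl mulr1 mul1r.
Qed.

Lemma selfadj1 : selfadj (1 : 'B(H)). Proof. by []. Qed.

Lemma selfadjD S T : selfadj S -> selfadj T -> selfadj (S + T).
Proof. by move=> sS sT x y; rewrite !bopDE innerDl innerDr sS sT. Qed.

Lemma selfadjB S T : selfadj S -> selfadj T -> selfadj (S - T).
Proof. by move=> sS sT x y; rewrite !bopBE innerBl innerBr sS sT. Qed.

Lemma selfadjZ r T : selfadj T -> selfadj (r%:C *: T).
Proof.
by move=> sT x y; rewrite !bopZE innerZl innerZRr sT.
Qed.

Lemma selfadjX T n : selfadj T -> selfadj (T ^+ n).
Proof.
move=> sT; elim: n => [//|n IHn] x y.
by rewrite [in LHS]exprSr exprS !bopME IHn sT.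
Qed.

Lemma selfadj_horner p A : selfadj A -> selfadj (horner_op p A).
Proof.
move=> sA; rewrite /horner_op; elim/big_ind: _ => [x y||i _].
- by rewrite !bop0E !(linear0l, linear0r).
- exact: selfadjD.
- exact/selfadjZ/selfadjX.
Qed.

Lemma invertibleM S T : invertible S -> invertible T -> invertible (S * T).
Proof.
move=> [S' [S'S SS']] [T' [T'T TT']]; exists (T' * S'); split.
  by rewrite mulrA -(mulrA T') S'S mulr1.
by rewrite mulrA -(mulrA S) TT' mulr1.
Qed.

Lemma invertibleZ (a : R[i]) S : a != 0 -> invertible S -> invertible (a *: S).
Proof.
move=> a0 [S' [S'S SS']]; exists (a^-1 *: S'); split.
  by rewrite -bop_scaleAl -bop_scaleAr S'S scalerA mulVf// scale1r.
by rewrite -bop_scaleAl -bop_scaleAr SS' scalerA mulfV// scale1r.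
Qed.

(** The inverse of [S * T] yields a left and a right inverse of [S], which then
    coincide. *)
Lemma invertible_factor S T : S * T = T * S -> invertible (S * T) -> invertible S.
Proof.
move=> ST [N [NST STN]]; exists (T * N).
have L : N * T * S = 1 by rewrite -mulrA -ST.
have Rt : S * (T * N) = 1 by rewrite mulrA.
by split => //; rewrite -[T * N]mul1r -L -(mulrA _ S) Rt mulr1.
Qed.

(** For [w = a + ib] and [D = A - a], the product [(D - ib) (D + ib) = D^2 + b^2]
    is coercive unless [b = 0]. *)
Lemma selfadj_spectrum_real A (w : R[i]) : selfadj A -> spectrum A w ->
  w = (complex.Re w)%:C.
Proof.
move: w => [a b] sA; have [->//|b0] := eqVneq b 0; case.
pose D := A - a%:C *: (1 : 'B(H)).
have sD : selfadj D.
  by apply: selfadjB => //; exact: selfadjZ.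
have AD : A - (a +i* b) *: (1 : 'B(H)) = D - (b%:C * 'i) *: (1 : 'B(H)).
  rewrite /D -addrA -opprD -scalerDl; congr (A - _ *: _).
  by apply/eqP; rewrite eq_complex /= !(mul0r, mulr0, mulr1, addr0, subr0, add0r) !eqxx.
have sqI : (b%:C * 'i) * (b%:C * 'i) = - (b ^+ 2)%:C :> R[i].
  by rewrite mulrACA -[X in _ * X]expr2 sqr_i mulrN1 -rmorphM expr2.
pose W := (b%:C * 'i) *: (1 : 'B(H)); rewrite -/W in AD.
have DW : D * W = W * D by rewrite /W -bop_scaleAr -bop_scaleAl mulr1 mul1r.
have WW : W * W = - ((b ^+ 2)%:C *: (1 : 'B(H))).
  by rewrite -bop_scaleAl mul1r scalerA sqI scaleNr.
clearbody D W.
have DD : (D - W) * (D + W) = D * D + (b ^+ 2)%:C *: (1 : 'B(H)).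
  by rewrite mulrDr !mulrBl DW WW opprK addrA subrK.
have DD' : (D + W) * (D - W) = D * D + (b ^+ 2)%:C *: (1 : 'B(H)).
  by rewrite mulrBr !mulrDl DW WW opprD opprK addrA addrK.
rewrite -/(invertible _) AD; apply: (@invertible_factor _ (D + W)).
  by rewrite DD DD'.
rewrite DD; apply: (@coercive_invertible _ _ _ (b ^+ 2)).
- apply: selfadjD; first exact: (@selfadjX D 2).
  exact/selfadjZ/selfadj1.
- by rewrite exprn_even_gt0.
- move=> x; rewrite bopDE bopME bopZE bop1E rinDl rinZl -nrm_sqr selfadj_rin//.
  by rewrite -nrm_sqr lerDr sqr_ge0.
Qed.

(** The polynomial splits into factors ['X - w] and no [w] lies in the spectrum.
    A nonempty spectrum excludes [q = 0]. *)
Lemma opev_invertible A (q : {poly R[i]}) : selfadj A ->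
  (exists t : R, spectrum A t%:C) ->
  (forall t : R, spectrum A t%:C -> ~~ root q t%:C) ->
  invertible (opev q A).
Proof.
move=> sA [t0 At0] qA.
have q0 : q != 0 by apply: contraNneq (qA _ At0) => ->; rewrite root0.
have [s qs] := closed_field_poly_normal q.
have {qA} As w : w \in s -> invertible (A - w *: (1 : 'B(H))).
  move=> ws; apply: contrapT => Aw; have wR := selfadj_spectrum_real sA Aw.
  rewrite wR in Aw ws; have := qA _ Aw; rewrite qs rootZ ?lead_coef_eq0//.
  by rewrite root_prod_XsubC ws.
rewrite qs opevZ; apply: invertibleZ; first by rewrite lead_coef_eq0.
elim: s As {qs} => [|w s IHs] As.
  by rewrite big_nil opevC scale1r; exists 1; rewrite mulr1.
rewrite big_cons opevM; apply: invertibleM.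
  by rewrite opevB opevX opevC; apply: As; rewrite mem_head.
by apply: IHs => v vs; apply: As; rewrite inE vs orbT.
Qed.

(** The square of the norm of a self-adjoint [Q] lies in the spectrum of [Q^2]:
    with [N] the norm and [D := N^2 - Q^2] one has
    [|D x|^2 <= N^2 (N^2 |x|^2 - |Q x|^2)], so a bounded inverse of [D] would
    make [N] non-optimal. *)
Lemma opnorm_sqr_not_invertible Q x : selfadj Q -> nrm x != 0 ->
  ~ invertible ((opnorm Q ^+ 2)%:C *: (1 : 'B(H)) - Q * Q).
Proof.
move=> sQ x0; set N := opnorm Q; set D := (X in invertible X) => -[S [SD _]].
have N0 : 0 <= N by exact: opnorm_ge0.
have QN := @nrm_opnorm _ _ Q; rewrite -/N in QN.
have [K K0 SK] := op_bounded S.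
pose L := K ^+ 2 * N ^+ 2.
have key y : nrm y ^+ 2 <= L * (N ^+ 2 * nrm y ^+ 2 - nrm (Q y) ^+ 2).
  have h1 : nrm y <= K * nrm (D y) by rewrite -{1}(bop1E y) -SD bopME SK.
  have h2 : nrm (D y) ^+ 2 <= N ^+ 2 * (N ^+ 2 * nrm y ^+ 2 - nrm (Q y) ^+ 2).
    rewrite nrm_sqr /D bopBE bopZE bop1E bopME !rinE.
    have E : rin (Q (Q y)) y = nrm (Q y) ^+ 2 by rewrite selfadj_rin// nrm_sqr.
    rewrite (rinC y (Q (Q y))) E -!nrm_sqr.
    have h3 : nrm (Q (Q y)) ^+ 2 <= N ^+ 2 * nrm (Q y) ^+ 2.
      by rewrite -exprMn lerXn2r ?nnegrE ?mulr_ge0 ?nrm_ge0.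
    lra.
  have h4 : nrm y ^+ 2 <= K ^+ 2 * nrm (D y) ^+ 2.
    by rewrite -exprMn lerXn2r ?nnegrE ?mulr_ge0 ?nrm_ge0.
  by rewrite (le_trans h4)// /L -mulrA ler_wpM2l ?sqr_ge0.
have nx : 0 < nrm x ^+ 2 by rewrite exprn_gt0// lt_def x0 nrm_ge0.
have L0 : 0 < L.
  rewrite lt_def mulr_ge0 ?sqr_ge0// andbT; apply/eqP => L0.
  by have := key x; rewrite L0 mul0r leNgt nx.
have key2 y : nrm (Q y) ^+ 2 <= (N ^+ 2 - L^-1) * nrm y ^+ 2.
  have := key y; rewrite -ler_pdivrMl// => h.
  by rewrite mulrBl; lra.
have NL : 0 <= N ^+ 2 - L^-1.
  by rewrite -(pmulr_lge0 _ nx) (le_trans _ (key2 x))// sqr_ge0.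
have : N <= Num.sqrt (N ^+ 2 - L^-1).
  apply: opnorm_le; first exact: sqrtr_ge0.
  move=> y; rewrite -ler_sqr ?nnegrE ?mulr_ge0 ?nrm_ge0 ?sqrtr_ge0//.
  by rewrite exprMn sqr_sqrtr.
rewrite -ler_sqr ?nnegrE ?sqrtr_ge0// sqr_sqrtr// lerBrDl gerDr leNgt.
by rewrite invr_gt0 L0.
Qed.

(** With [N] the norm, [N^2 - A^2 = - (A - N) (A + N)] is not invertible, so [N]
    or [- N] is in the spectrum. *)
Lemma selfadj_spectrum_nonempty A x : selfadj A -> nrm x != 0 ->
  exists t : R, spectrum A t%:C.
Proof.
move=> sA x0; pose N := opnorm A.
apply: contrapT => nA; apply: (opnorm_sqr_not_invertible sA x0).
have inv (t : R) : invertible (A - t%:C *: (1 : 'B(H))).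
  by apply: contrapT => At; apply: nA; exists t.
have -> : (opnorm A ^+ 2)%:C *: (1 : 'B(H)) - A * A =
    horner_op (N ^+ 2)%:P A - horner_op ('X * 'X) A.
  by rewrite horner_opM horner_opC horner_opX.
have fact : (N ^+ 2)%:P - 'X * 'X =
    (-1)%:P * (('X - N%:P) * ('X - (- N)%:P)) :> {poly R}.
  by rewrite !polyCN polyC_exp; ring.
rewrite -horner_opB fact !horner_opM !horner_opB !horner_opC horner_opX.
rewrite -bop_scaleAl mul1r; apply: invertibleZ; last exact: invertibleM.
by rewrite rmorphN1 oppr_eq0 oner_eq0.
Qed.

(** The spectral mapping theorem in the form of a norm bound: if [N] is the
    norm of [p(A)] and exceeds [c], the roots of [N^2 - p^2] miss the spectrum
    of [A], so [N^2 - p(A)^2] is a product of invertible factors. *)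
Lemma horner_op_bound A p (c : R) : selfadj A -> 0 <= c ->
  (forall t : R, spectrum A t%:C -> `|p.[t]| <= c) ->
  bounded_by c (horner_op p A).
Proof.
move=> sA c0 pc; set Q := horner_op p A; pose N := opnorm Q.
have sQ : selfadj Q by exact: selfadj_horner.
have [Nc x|cN x] := leP N c.
  by rewrite (le_trans (nrm_opnorm Q x))// ler_wpM2r ?nrm_ge0.
have [x0|x0] := eqVneq (nrm x) 0; first by rewrite (nrm_eq0 x0) linear0 nrm0 mulr0.
exfalso; apply: (opnorm_sqr_not_invertible sQ x0); rewrite -/N.
pose q := (N ^+ 2)%:P - p * p.
have -> : (N ^+ 2)%:C *: (1 : 'B(H)) - Q * Q = horner_op q A.
  by rewrite horner_opB horner_opM horner_opC.
rewrite horner_opE; apply: opev_invertible => //.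
  exact: selfadj_spectrum_nonempty x0.
move=> t At; rewrite rootE horner_map fmorph_eq0.
rewrite !hornerE -expr2 subr_eq0 gt_eqF// -[ltLHS]real_normK ?num_real//.
by rewrite ltr_sqr ?nnegrE ?opnorm_ge0// (le_lt_trans (pc t At)).
Qed.

Lemma positive_rin A x : positive_op A -> 0 <= rin (A x) x.
Proof. by move=> /(_ x); rewrite lecE => /andP[]. Qed.

(** Polarisation: a form that is real on the diagonal is Hermitian. *)
Lemma positive_selfadj A : positive_op A -> selfadj A.
Proof.
move=> pA x y; rewrite [RHS]innerC.
have real z : complex.Im (inner (A z) z) = 0 by rewrite ger0_Im// pA.
have := real (x + 'i *: y); have := real (x + y).
rewrite !opD opZ !innerDl !innerDr !innerZl !innerZr.
move: (real x) (real y).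
case: (inner (A x) x) (inner (A y) y) (inner (A x) y) (inner (A y) x) =>
  [a1 b1] [a2 b2] [a3 b3] [a4 b4] /= -> -> h1 h2.
by apply/eqP; rewrite eq_complex /=; apply/andP; split; apply/eqP; lra.
Qed.

(** Outside of [[0, M]] one of [A - t] and [t - A] is coercive. *)
Lemma positive_spectrum A (M t : R) : positive_op A -> bounded_by M A ->
  spectrum A t%:C -> 0 <= t <= M.
Proof.
move=> pA AM At; have sA := positive_selfadj pA.
have sgn x : 0 <= rin (A x) x <= M * nrm x ^+ 2.
  rewrite positive_rin//= (le_trans (ler_norm _))// (le_trans (rin_CS _ _))//.
  by rewrite expr2 mulrA ler_wpM2r ?nrm_ge0.
apply/andP; split; rewrite leNgt; apply/negP => tM; apply: At.
  apply: (@coercive_invertible _ _ _ (- t)); last 2 first.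
  - by rewrite oppr_gt0.
  - by move=> x; rewrite bopBE bopZE bop1E !rinE -nrm_sqr; have := sgn x; lra.
  by apply: selfadjB => //; exact: selfadjZ.
rewrite -/(invertible _) -opprB -scaleN1r.
apply: invertibleZ; first by rewrite oppr_eq0 oner_eq0.
apply: (@coercive_invertible _ _ _ (t - M)); last 2 first.
- by rewrite subr_gt0.
- by move=> x; rewrite bopBE bopZE bop1E !rinE -nrm_sqr; have := sgn x; lra.
by apply: selfadjB => //; exact: selfadjZ.
Qed.

End RealPolynomials.

(** * Continuous functional calculus of a positive operator *)

Section Limits.
Variable R : realType.

Lemma le_harmonic (a b C : R) : (forall n : nat, a <= b + C / n.+1%:R) -> a <= b.
Proof.
move=> abC; apply/ler_addgt0Pr => e e0.
apply: (le_trans (abC (Num.truncn (`|C| / e)))); rewrite lerD2l.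
rewrite ler_pdivrMr// (le_trans (ler_norm C))// mulrC -ler_pdivrMr// ltW//.
exact: truncnS_gt.
Qed.

Lemma uniform_cvgP (D : set R) (u : nat -> R -> R) (f : R -> R) :
  {uniform D, u @ \oo --> f} <->
  forall e, 0 < e -> exists N, forall n, (N <= n)%N ->
    forall t, D t -> `|u n t - f t| < e.
Proof.
split=> [uf e e0|uf].
  have : nbhs (f : {uniform` D -> R}) [set h | forall t, D t -> `|h t - f t| < e].
    apply/uniform_nbhs; exists [set xy | ball xy.1 e xy.2]; split.
      exact: (entourage_ball _ (PosNum e0)).
    by move=> h /= hf t Dt; have := hf t Dt; rewrite -ball_normE/= distrC.
  by move/uf => [N _ HN]; exists N => n Nn t Dt; exact: (HN n Nn).
move=> P /uniform_nbhs[E [+ EP]]; rewrite -entourage_ballE => -[e /= e0 eE].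
have [N HN] := uf e e0; exists N => // n Nn; apply: EP => t Dt; apply: eE.
by rewrite /= -ball_normE/= distrC; exact: HN.
Qed.

End Limits.

Section FunctionalCalculus.
Variables (R : realType) (H : hilbertType R).
Implicit Types (S T A B V : 'B(H)) (x y z : H) (p q : {poly R}) (f g : R -> R).

(** A form of [S = f(A)] in which no approximating sequence is singled out: the
    same polynomials can then serve for several operators at once, and errors
    add up explicitly. *)
Definition is_calculus (M : R) f A S := forall p e,
  (forall t, 0 <= t <= M -> `|p.[t] - f t| <= e) -> bounded_by e (horner_op p A - S).

Lemma horner_op_segment_bound A (M : R) p c : 0 <= M -> positive_op A -> bounded_by M A ->
  (forall t, 0 <= t <= M -> `|p.[t]| <= c) -> bounded_by c (horner_op p A).
Proof.
move=> M0 pA AM pc; apply: horner_op_bound; first exact: positive_selfadj.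
  by apply: le_trans (pc 0 _); rewrite ?normr_ge0 ?lexx.
by move=> t /(positive_spectrum pA AM); exact: pc.
Qed.

Lemma calculus_poly A (M : R) q : 0 <= M -> positive_op A -> bounded_by M A ->
  is_calculus M (fun t => q.[t]) A (horner_op q A).
Proof.
move=> M0 pA AM p e pq; rewrite -horner_opB.
by apply: (horner_op_segment_bound M0) => // t tM; rewrite !hornerE pq.
Qed.

Section Fixed.
Variables (M : R) (M0 : 0 < M).

Local Notation cont f := {within `[0, M], continuous f}.

Lemma approx_seq f : cont f -> exists p : nat -> {poly R}, forall n t, 0 <= t <= M ->
  `|(p n).[t] - f t| <= n.+1%:R^-1.
Proof.
move=> cf; suff /choice[p Hp] : forall n : nat, exists p : {poly R}, forall t, 0 <= t <= M ->
    `|p.[t] - f t| <= n.+1%:R^-1 by exists p.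
by move=> n; apply: weierstrass => //; rewrite invr_gt0.
Qed.

(** Polynomials intertwine, and one sequence of polynomials approximates both
    [f(A)] and [f(B)]. *)
Lemma calculus_intertwine f A B V S T : cont f -> V * A = B * V ->
  is_calculus M f A S -> is_calculus M f B T -> V * S = T * V.
Proof.
move=> cf VA fS fT; apply: bopP => x; rewrite !bopME.
have [p Hp] := approx_seq cf; have [K K0 VK] := op_bounded V.
apply/subr0_eq/nrm_eq0/eqP; rewrite eq_le nrm_ge0 andbT.
apply: (@le_harmonic _ _ _ (2 * K * nrm x)) => n; rewrite add0r.
have E : V (horner_op (p n) A x) = horner_op (p n) B (V x).
  by rewrite -!bopME (horner_op_intertwine _ VA).
rewrite (le_trans (nrmB _ _ (V (horner_op (p n) A x))))//.
rewrite -opB E -(bopBE _ T).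
have h1 := fS _ _ (Hp n) x; have h2 := fT _ _ (Hp n) (V x).
have h3 := VK x; have h4 := VK ((horner_op (p n) A - S) x).
have -> : 2 * K * nrm x / n.+1%:R =
    K * (n.+1%:R^-1 * nrm x) + n.+1%:R^-1 * (K * nrm x) by ring.
rewrite lerD//.
  by rewrite -nrmN -opN opprB -bopBE (le_trans h4)// ler_wpM2l.
by rewrite (le_trans h2)// ler_wpM2l// invr_ge0.
Qed.

Lemma calculus_unique f A S T : cont f ->
  is_calculus M f A S -> is_calculus M f A T -> S = T.
Proof.
move=> cf fS fT; have := @calculus_intertwine f A A 1 S T cf _ fS fT.
by rewrite !mul1r !mulr1; apply.
Qed.

Lemma calculus_selfadj f A S : cont f -> selfadj A -> is_calculus M f A S -> selfadj S.
Proof.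
move=> cf sA fS x y; have [p Hp] := approx_seq cf.
apply/subr0_eq/Normc.eq0_normc/eqP; rewrite eq_le normc_ge0 andbT.
apply: (@le_harmonic _ _ _ (2 * nrm x * nrm y)) => n; rewrite add0r.
have sp := selfadj_horner (p n) sA.
have -> : inner (S x) y - inner x (S y) =
    inner x ((horner_op (p n) A - S) y) - inner ((horner_op (p n) A - S) x) y.
  by rewrite !bopBE innerBl innerBr sp; ring.
rewrite (le_trans (le_normcD _ _))// normcN.
have := inner_CS x ((horner_op (p n) A - S) y).
have := inner_CS ((horner_op (p n) A - S) x) y.
have h1 := fS _ _ (Hp n) x; have h2 := fS _ _ (Hp n) y.
have h3 := nrm_ge0 x; have h4 := nrm_ge0 y => h5 h6.
have -> : 2 * nrm x * nrm y / n.+1%:R =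
   nrm x * (n.+1%:R^-1 * nrm y) + (n.+1%:R^-1 * nrm x) * nrm y by ring.
by rewrite lerD// (le_trans h6, le_trans h5)// (ler_wpM2l, ler_wpM2r).
Qed.

Variables (A : 'B(H)) (posA : positive_op A) (AM : bounded_by M A).

Let bnd p c : (forall t, 0 <= t <= M -> `|p.[t]| <= c) -> bounded_by c (horner_op p A).
Proof. exact: horner_op_segment_bound (ltW M0) posA AM. Qed.

(** If [p n] is within [1 / (n + 1)] of [f] on [[0, M]], the operators [p n (A)]
    are Cauchy in norm, since the norm of [q(A)] is at most the supremum of
    [`|q|] over [[0, M]]. *)
Lemma calculus_exists f : cont f -> exists S, is_calculus M f A S.
Proof.
move=> cf; have [p Hp] := approx_seq cf.
have near q e n : (forall t, 0 <= t <= M -> `|q.[t] - f t| <= e) ->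
    bounded_by (e + n.+1%:R^-1) (horner_op q A - horner_op (p n) A).
  move=> Hq; rewrite -horner_opB; apply: bnd => t tM; rewrite !hornerE.
  have := ler_distD (f t) q.[t] (p n).[t] => /le_trans; apply.
  by rewrite lerD ?Hq// distrC Hp.
have /choice[s Hs] x : exists l, forall n,
    nrm (horner_op (p n) A x - l) <= 2 * nrm x / n.+1%:R.
  apply: nrm_complete; first by rewrite mulr_ge0// nrm_ge0.
  move=> m n mn; rewrite -bopBE (le_trans (near _ _ _ (Hp m) x))//.
  rewrite mulrAC ler_wpM2r ?nrm_ge0// mulrDl mul1r lerD2l.
  by rewrite lef_pV2 ?posrE// ler_nat ltnS.
have ls : linear s.
  move=> a x y; apply/subr0_eq/nrm_eq0/eqP; rewrite eq_le nrm_ge0 andbT.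
  apply: (@le_harmonic _ _ _ (2 * nrm (a *: x + y) + Normc.normc a * (2 * nrm x) + 2 * nrm y)).
  move=> n; rewrite add0r.
  have h1 := Hs (a *: x + y) n; have h2 := Hs x n; have h3 := Hs y n.
  have -> : s (a *: x + y) - (a *: s x + s y) =
     - (horner_op (p n) A (a *: x + y) - s (a *: x + y)) +
     a *: (horner_op (p n) A x - s x) + (horner_op (p n) A y - s y).
    rewrite opD opZ opprB scalerBr -[RHS]addrA (addrACA (a *: _)) [RHS]addrA.
    by rewrite subrK opprD.
  rewrite (le_trans (nrmD _ _))// 2![(_ + _) / _]mulrDl lerD// (le_trans (nrmD _ _))// lerD//.
    by rewrite nrmN.
  by rewrite nrmZ -mulrA ler_wpM2l ?normc_ge0.
have [K K0 pK] := op_bounded (horner_op (p 0) A).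
have [|S HS] := @bounded_op_exists _ _ s (K + 2) ls.
  move=> x; have := Hs x 0; have := pK x; rewrite divr1.
  have := nrmD (horner_op (p 0) A x) (- (horner_op (p 0) A x - s x)).
  by rewrite nrmN opprB addrCA subrr addr0; lra.
exists S => q e Hq x; apply: (@le_harmonic _ _ _ (3 * nrm x)) => n.
rewrite bopBE HS (le_trans (nrmB _ _ (horner_op (p n) A x)))// -bopBE.
have := near _ _ n Hq x; have := Hs x n.
have -> : 3 * nrm x / n.+1%:R = n.+1%:R^-1 * nrm x + 2 * nrm x / n.+1%:R by ring.
by move: (n.+1%:R^-1) => d; lra.
Qed.

(** If [p1] and [p2] approximate [f] and [g], their product approximates both
    [f g] on the interval and [S T] at [A]. *)
Lemma calculus_mul f g S T : cont f -> cont g ->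
  is_calculus M f A S -> is_calculus M g A T ->
  is_calculus M (fun t => f t * g t) A (S * T).
Proof.
move=> cf cg fS gT p e Hp x.
have [F fF] := segment_bounded cf; have [G gG] := segment_bounded cg.
have [p1 Hp1] := approx_seq cf; have [p2 Hp2] := approx_seq cg.
have [K K0 TK] := op_bounded T.
apply: (@le_harmonic _ _ _ (((F + (G + 1)) + (F + 1) + K) * nrm x)) => n.
have n1 : n.+1%:R^-1 <= 1 :> R by rewrite invf_le1// ler1n.
have n0 : 0 <= n.+1%:R^-1 :> R by rewrite invr_ge0.
have F1 : bounded_by (F + 1) (horner_op (p1 n) A).
  apply: bnd => t tM; rewrite -[_.[t]](subrK (f t)) addrC.
  by rewrite (le_trans (ler_normD _ _))// lerD ?fF// (le_trans (Hp1 _ _ tM)).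
have h1 : nrm ((horner_op p A - horner_op (p1 n) A * horner_op (p2 n) A) x) <=
    (e + n.+1%:R^-1 * (F + (G + 1))) * nrm x.
  rewrite -horner_opM -horner_opB; apply: bnd => t tM; rewrite hornerD hornerN hornerM.
  have -> : p.[t] - (p1 n).[t] * (p2 n).[t] = (p.[t] - f t * g t) +
    (f t * (g t - (p2 n).[t]) + (f t - (p1 n).[t]) * (p2 n).[t]) by ring.
  rewrite (le_trans (ler_normD _ _))// lerD ?Hp//.
  rewrite (le_trans (ler_normD _ _))// !normrM.
  have p2G : `|(p2 n).[t]| <= G + 1.
    rewrite -[(p2 n).[t]](subrK (g t)) addrC.
    by rewrite (le_trans (ler_normD _ _))// lerD ?gG// (le_trans (Hp2 _ _ tM)).
  rewrite (distrC (g t)) (distrC (f t)).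
  have -> : n.+1%:R^-1 * (F + (G + 1)) = F * n.+1%:R^-1 + n.+1%:R^-1 * (G + 1) by ring.
  apply: lerD; apply: ler_pM => //; [exact: fF|exact: Hp2|exact: Hp1].
have h2 := F1 ((horner_op (p2 n) A - T) x).
have h3 := gT _ _ (Hp2 n) x.
have h4 := fS _ _ (Hp1 n) (T x); have h5 := TK x.
have F0 : 0 <= F + 1.
  have := fF 0; rewrite lexx (ltW M0) => /(_ isT) h.
  by rewrite addr_ge0// (le_trans _ h).
have -> : (horner_op p A - S * T) x =
    (horner_op p A - horner_op (p1 n) A * horner_op (p2 n) A) x +
    (horner_op (p1 n) A ((horner_op (p2 n) A - T) x) +
     (horner_op (p1 n) A - S) (T x)).
  by rewrite !bopBE !bopME opB !subrKA.
rewrite (le_trans (nrmD _ _))//.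
have h6 := nrmD (horner_op (p1 n) A ((horner_op (p2 n) A - T) x)) ((horner_op (p1 n) A - S) (T x)).
have h7 := ler_wpM2l F0 h3; have h8 := ler_wpM2l n0 h5.
move: (n.+1%:R^-1) h1 h2 h4 h6 h7 h8 => d h1 h2 h4 h6 h7 h8.
have -> : e * nrm x + (F + (G + 1) + (F + 1) + K) * nrm x * d =
  (e + d * (F + (G + 1))) * nrm x + ((F + 1) * (d * nrm x) + d * (K * nrm x)) by ring.
lra.
Qed.

Lemma calculus_is_funcalc f S : is_calculus M f A S -> cont f -> is_funcalc f A S.
Proof.
move=> fS cf; have [p Hp] := approx_seq cf.
have small e : 0 < e -> exists N : nat, forall n, (N <= n)%N -> n.+1%:R^-1 < e :> R.
  move=> e0; exists (Num.truncn e^-1) => n Nn.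
  rewrite -[e]invrK ltf_pV2 ?posrE ?invr_gt0// (lt_le_trans (truncnS_gt _))//.
  by rewrite ler_nat ltnS.
exists p; split.
  apply/uniform_cvgP => e e0; have [N HN] := small e e0.
  exists N => n Nn t /= /(positive_spectrum posA AM) tM.
  by rewrite (le_lt_trans (Hp n t tM))// HN.
apply/cvgrPdist_lt => e e0; have [N HN] := small e e0; exists N => // n /= Nn.
rewrite sub0r normrN ger0_norm ?opnorm_ge0// (le_lt_trans _ (HN n Nn))//.
by apply: opnorm_le; [rewrite invr_ge0|exact: (fS _ _ (Hp n))].
Qed.

(** The polynomials defining [S] are controlled on the spectrum only. This is
    enough because [horner_op_bound] sees nothing else. *)
Lemma is_funcalc_calculus f S : is_funcalc f A S -> is_calculus M f A S.
Proof.
move=> [q [/uniform_cvgP qf qS]] p e Hp x.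
apply: (@le_harmonic _ _ _ (2 * nrm x)) => n.
have d0 : 0 < n.+1%:R^-1 :> R by rewrite invr_gt0.
have [N HN] := qf _ d0; have /cvgrPdist_lt/(_ _ d0)[N' _ HN'] := qS.
pose k := maxn N N'; have {}HN := HN k (leq_maxl _ _).
have kS : opnorm (horner_op (q k) A - S) < n.+1%:R^-1.
  by have /= := HN' k (leq_maxr _ _); rewrite sub0r normrN ger0_norm ?opnorm_ge0.
have h1 : bounded_by (e + n.+1%:R^-1) (horner_op p A - horner_op (q k) A).
  rewrite -horner_opB; apply: horner_op_bound; first exact: positive_selfadj.
    rewrite addr_ge0// ?(ltW d0)//; apply: le_trans (Hp 0 _); rewrite ?normr_ge0//.
    by rewrite lexx ltW.
  move=> t At; have tM := positive_spectrum posA AM At; rewrite !hornerE.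
  have := ler_distD (f t) p.[t] (q k).[t] => /le_trans; apply.
  by rewrite lerD ?Hp// distrC ltW// HN.
rewrite bopBE (le_trans (nrmB _ _ (horner_op (q k) A x)))// -!bopBE.
have := h1 x; have := nrm_opnorm (horner_op (q k) A - S) x.
have := ler_wpM2r (nrm_ge0 x) (ltW kS).
by move: (n.+1%:R^-1) => d; lra.
Qed.

Lemma funcalc_calculus f : cont f -> is_calculus M f A (funcalc f A).
Proof.
move=> cf; have [S fS] := calculus_exists cf.
apply: is_funcalc_calculus.
exact: (@xgetI _ 0 (is_funcalc f A) S (calculus_is_funcalc fS cf)).
Qed.

End Fixed.

(** Positive square roots are values of the functional calculus: if [p] is
    close to the square root on [[0, M^2]], then [p] composed with the square
    function is close to the identity on [[0, M]]. *)
Lemma positive_root_calculus S (M : R) : 0 <= M -> positive_op S -> bounded_by M S ->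
  is_calculus (M ^+ 2) Num.sqrt (S * S) S.
Proof.
move=> M0 pS SM p e Hp.
have -> : horner_op p (S * S) = horner_op (p \Po ('X * 'X)) S.
  by rewrite horner_op_comp horner_opM horner_opX.
rewrite -{2}[S]horner_opX; apply: (calculus_poly (q := 'X) M0) => // t /andP[t0 tM].
rewrite horner_comp hornerM hornerX -expr2.
have := Hp (t ^+ 2); rewrite sqrtr_sqr (ger0_norm t0); apply.
by rewrite sqr_ge0 lerXn2r ?nnegrE.
Qed.

Lemma bounded_op_pos A : exists2 M : R, 0 < M & bounded_by M A.
Proof.
have [M M0 AM] := op_bounded A; exists (M + 1); first by rewrite ltr_wpDl.
by move=> x; rewrite (le_trans (AM x))// ler_wpM2r ?nrm_ge0// lerDl.
Qed.

Lemma sqrt_cont (M : R) : {within `[0, M], continuous (@Num.sqrt R)}.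
Proof. by apply: continuous_subspaceT => x; exact: sqrt_continuous. Qed.

(** The functional calculus of the fourth root gives a self-adjoint [S], whose
    square is therefore positive and is a square root of [P]. *)
Lemma positive_root_exists P : positive_op P -> exists S, positive_op S /\ S * S = P.
Proof.
move=> pP; have [M M0 PM] := bounded_op_pos P.
have cq : {within `[0, M], continuous (fun t : R => Num.sqrt (Num.sqrt t))}.
  apply: continuous_subspaceT => x; apply: continuous_comp; exact: sqrt_continuous.
have [S qS] := calculus_exists M0 pP PM cq.
have sS := calculus_selfadj M0 cq (positive_selfadj pP) qS.
have ext f g T : (forall t, 0 <= t <= M -> f t = g t) -> is_calculus M f P T -> is_calculus M g P T.
  by move=> fg fT p e Hp; apply: fT => t tM; rewrite fg// Hp.
have rS : is_calculus M Num.sqrt P (S * S).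
  apply: ext (calculus_mul M0 pP PM cq cq qS qS) => t /andP[t0 _].
  by rewrite -expr2 sqr_sqrtr ?sqrtr_ge0.
exists (S * S); split.
  by move=> x; rewrite bopME sS inner_nrm ler0c sqr_ge0.
apply: (@calculus_unique M M0 (fun t => t) P).
- by apply: continuous_subspaceT => x; exact: cvg_id.
- apply: ext (calculus_mul M0 pP PM (@sqrt_cont M) (@sqrt_cont M) rS rS) => t /andP[t0 _].
  by rewrite -expr2 sqr_sqrtr.
- have := calculus_poly (q := 'X) (ltW M0) pP PM; rewrite horner_opX; apply: ext => t _.
  by rewrite hornerX.
Qed.

End FunctionalCalculus.

(** * The mixed Schwarz inequality *)

Section MixedSchwarz.
Variables (R : realType) (H : hilbertType R).
Implicit Types (S T A B V : 'B(H)) (x y z : H) (p q : {poly R}).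

Lemma absop_spec T : positive_op (absop T) /\ absop T * absop T = adjoint T * T.
Proof.
have [S HS] : exists S, positive_op S /\ S * S = adjoint T * T.
  apply: positive_root_exists => x.
  by rewrite bopME adjoint_spec2 inner_nrm ler0c sqr_ge0.
exact: (@xgetI _ 0 [set S | positive_op S /\ S * S = adjoint T * T] S HS).
Qed.

Lemma nrm_absop T x : nrm (absop T x) = nrm (T x).
Proof.
have [pA AA] := absop_spec T.
apply/eqP; rewrite -(@eqrXn2 _ 2) ?nrm_ge0// !nrm_sqr /rin.
by rewrite (positive_selfadj pA) -bopME AA bopME adjoint_spec.
Qed.

(** [T] intertwines the squares [T^* T] and [T T^*] of the two absolute values,
    hence also the values of the functional calculus at these, among which are
    the absolute values themselves. *)
Lemma absop_intertwine T : T * absop T = absop (adjoint T) * T.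
Proof.
have [pA AA] := absop_spec T; have [pB BB] := absop_spec (adjoint T).
have [M M0 AM] := bounded_op_pos (absop T).
have [N N0 BN] := bounded_op_pos (absop (adjoint T)).
pose K := M + N; have K0 : 0 < K by rewrite addr_gt0.
have AK : bounded_by K (absop T).
  by move=> x; rewrite (le_trans (AM x))// ler_wpM2r ?nrm_ge0// lerDl ltW.
have BK : bounded_by K (absop (adjoint T)).
  by move=> x; rewrite (le_trans (BN x))// ler_wpM2r ?nrm_ge0// lerDr ltW.
have K20 : 0 < K ^+ 2 by rewrite exprn_gt0.
apply: (@calculus_intertwine _ _ _ K20 Num.sqrt (absop T * absop T)
  (absop (adjoint T) * absop (adjoint T))).
- exact: sqrt_cont.
- by rewrite AA BB adjointK mulrA.
- by apply: positive_root_calculus => //; exact: ltW.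
- by apply: positive_root_calculus => //; exact: ltW.
Qed.

(** A consequence of [(1 + N s) (1 - s)^N <= 1], which follows by induction. *)
Lemma bernoulli_bound (N : nat) (s : R) : 0 <= s <= 1 -> s * (1 - s) ^+ N <= N.+1%:R^-1.
Proof.
move=> /andP[s0 s1].
have pow n : 0 <= (1 - s) ^+ n by rewrite exprn_ge0// subr_ge0.
have key : (1 + N%:R * s) * (1 - s) ^+ N <= 1.
  elim: N => [|N IHN]; first by rewrite mul0r addr0 mulr1.
  apply: le_trans IHN; rewrite exprSr mulrA [leLHS]mulrAC ler_wpM2r//.
  rewrite -natr1; have : 0 <= (N%:R + 1) * s ^+ 2 by rewrite mulr_ge0 ?addr_ge0 ?sqr_ge0.
  by lra.
rewrite -[leRHS]mulr1 ler_pdivlMl// mulrA (le_trans _ key)// ler_wpM2r//.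
by rewrite -natr1 mulrDl mul1r addrC lerD2r.
Qed.

(** A polynomial substitute for [1 / t] on [[0, M]]: there [t r(t)] stays in
    [[0, 1]], while [t (1 - t r(t)) = t (1 - t / M)^N] is uniformly small, by
    [bernoulli_bound]. *)
Lemma pseudo_inverse_poly (M : R) (N : nat) : M != 0 ->
  exists r : {poly R}, 'X * r = 1 - (1 - M^-1 *: 'X) ^+ N.
Proof.
move=> M0; elim: N => [|N [r Hr]]; first by exists 0; rewrite mulr0 subrr.
exists (r + M^-1 *: (1 - M^-1 *: 'X) ^+ N).
by rewrite mulrDr Hr exprS -!mul_polyC; ring.
Qed.

(** An approximate polar decomposition [T ~ V |T|]. The partial isometry of the
    exact one is a limit of [T r(|T|)] with [r] a polynomial; such a [V] is
    already a contraction and intertwines [|T|] and [|T^*|]. *)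
Lemma approx_polar T (M : R) (N : nat) : 0 < M -> bounded_by M (absop T) ->
  exists V, [/\ V * absop T = absop (adjoint T) * V,
    (forall x, nrm (V x) <= nrm x) &
    forall x, nrm (T x - V (absop T x)) <= M * nrm x / N.+1%:R].
Proof.
move=> M0 AM; set A := absop T; have [pA _] := absop_spec T.
have [r Hr] := pseudo_inverse_poly N (lt0r_neq0 M0).
have scaled t : 0 <= t <= M -> 0 <= M^-1 * t <= 1.
  move=> /andP[t0 tM]; rewrite mulr_ge0 ?invr_ge0 ?(ltW M0)//=.
  by rewrite ler_pdivrMl// mulr1.
have ArA : horner_op r A * A = A * horner_op r A.
  by rewrite (horner_op_intertwine r (erefl (A * A))).
exists (T * horner_op r A); split.
- by rewrite -mulrA ArA !mulrA absop_intertwine.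
- move=> x; rewrite bopME -nrm_absop -/A -bopME -{1}(horner_opX A) -horner_opM Hr.
  rewrite -[leRHS]mul1r; apply: (horner_op_segment_bound (ltW M0) pA AM) => t /scaled.
  rewrite !(hornerE, horner_exp) => /andP[s0 s1].
  have h0 : 0 <= (1 - M^-1 * t) ^+ N by rewrite exprn_ge0// subr_ge0.
  have h1 : (1 - M^-1 * t) ^+ N <= 1 by rewrite exprn_ile1 ?subr_ge0// gerBl.
  by rewrite ger0_norm; lra.
- move=> x; rewrite bopME -opB -nrm_absop -/A.
  have -> : A (x - horner_op r A (A x)) = horner_op ('X * (1 - M^-1 *: 'X) ^+ N) A x.
    have -> : (1 - M^-1 *: 'X) ^+ N = 1 - 'X * r by rewrite Hr subKr.
    by rewrite horner_opM horner_opB horner_opM horner_opX -[1]/(1%:P) horner_opC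
      scale1r bopME bopBE bop1E -ArA.
  rewrite mulrAC; apply: (horner_op_segment_bound (ltW M0) pA AM) => t tM.
  have /andP[s0 s1] := scaled t tM; have /andP[t0 _] := tM.
  rewrite !(hornerE, horner_exp) ger0_norm ?mulr_ge0 ?exprn_ge0 ?subr_ge0//.
  by rewrite -ler_pdivrMl// mulrA bernoulli_bound// scaled.
Qed.

Variables (f g : R -> R).
Hypotheses (cf : {within `[0, +oo[, continuous f}) (cg : {within `[0, +oo[, continuous g}).

Let cont_segment (M : R) (h : R -> R) : {within `[0, +oo[, continuous h} ->
  {within `[0, M], continuous h}.
Proof.
by apply: continuous_subspaceW => x /=; rewrite !in_itv/= => /andP[-> _].
Qed.

Lemma funcalc_selfadj A : positive_op A -> selfadj (funcalc f A).
Proof.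
move=> pA; have [M M0 AM] := bounded_op_pos A.
have fA := funcalc_calculus M0 pA AM (cont_segment (M := M) cf).
exact (calculus_selfadj M0 (cont_segment (M := M) cf) (positive_selfadj pA) fA).
Qed.

Lemma funcalc_sqrE A x : positive_op A ->
  inner ((funcalc f A ^+ 2) x) x = (nrm (funcalc f A x) ^+ 2)%:C.
Proof. by move=> pA; rewrite expr2 bopME funcalc_selfadj// inner_nrm. Qed.

Hypothesis fgE : forall t : R, 0 <= t -> f t * g t = t.

Lemma funcalc_factor A : positive_op A -> funcalc g A * funcalc f A = A.
Proof.
move=> pA; have [M M0 AM] := bounded_op_pos A.
have fA := funcalc_calculus M0 pA AM (cont_segment (M := M) cf).
have gA := funcalc_calculus M0 pA AM (cont_segment (M := M) cg).
apply: (@calculus_unique _ _ M M0 (fun t => t) A).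
- by apply: continuous_subspaceT => x; exact: cvg_id.
- move=> p e Hp; apply: (calculus_mul M0 pA AM _ _ gA fA); try exact: cont_segment.
  by move=> t /[dup] tM /andP[t0 _]; rewrite mulrC fgE// Hp.
- have := calculus_poly (q := 'X) (ltW M0) pA AM; rewrite horner_opX => XA p e Hp.
  by apply: XA => t tM; rewrite hornerX Hp.
Qed.

(** With [V] an approximate polar factor, [T x] is close to
    [V |T| x = V g(|T|) f(|T|) x = g(|T^*|) V f(|T|) x]; moving the self-adjoint
    [g(|T^*|)] to the other side and using that [V] is a contraction gives the
    bound. *)
Lemma mixed_schwarz T x y : Normc.normc (inner (T x) y) <=
  nrm (funcalc f (absop T) x) * nrm (funcalc g (absop (adjoint T)) y).
Proof.
set A := absop T; set B := absop (adjoint T).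
have [pA _] := absop_spec T; have [pB _] := absop_spec (adjoint T).
have [M M0 AM] := bounded_op_pos A.
have [M' M'0 BM] := bounded_op_pos B.
pose K := M + M'; have K0 : 0 < K by rewrite addr_gt0.
have {}AM : bounded_by K A.
  by move=> u; rewrite (le_trans (AM u))// ler_wpM2r ?nrm_ge0// lerDl ltW.
have {}BM : bounded_by K B.
  by move=> u; rewrite (le_trans (BM u))// ler_wpM2r ?nrm_ge0// lerDr ltW.
have cgK := cont_segment (M := K) cg.
have gA := funcalc_calculus K0 pA AM cgK.
have gB := funcalc_calculus K0 pB BM cgK.
have sB := calculus_selfadj K0 cgK (positive_selfadj pB) gB.
apply: (@le_harmonic _ _ _ (K * nrm x * nrm y)) => N.
have [V [VAB Vx TV]] := approx_polar N K0 AM.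
have VG := calculus_intertwine K0 cgK VAB gA gB.
have -> : inner (T x) y = inner (V (funcalc f A x)) (funcalc g B y) +
    inner (T x - V (A x)) y.
  rewrite -sB -!bopME -VG -mulrA -[in LHS](subrK (V (A x)) (T x)).
  by rewrite funcalc_factor// innerDl addrC.
rewrite (le_trans (le_normcD _ _))// lerD//.
  by rewrite (le_trans (inner_CS _ _))// ler_wpM2r ?nrm_ge0.
by rewrite (le_trans (inner_CS _ _))// mulrAC ler_wpM2r ?nrm_ge0.
Qed.

End MixedSchwarz.

(** * Euclidean operator radius of an operator matrix *)

Section EuclideanNorm.
Variables (R : realType) (d : nat).
Implicit Types u v : 'I_d -> R.

Definition l2 u : R := Num.sqrt (\sum_k u k ^+ 2).

Lemma sum_sqr_ge0 u : 0 <= \sum_k u k ^+ 2.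
Proof. by apply: sumr_ge0 => k _; exact: sqr_ge0. Qed.

Lemma l2_ge0 u : 0 <= l2 u. Proof. exact: sqrtr_ge0. Qed.

Lemma l2_sqr u : l2 u ^+ 2 = \sum_k u k ^+ 2.
Proof. by rewrite sqr_sqrtr// sum_sqr_ge0. Qed.

Lemma l2_le u v : (forall k, 0 <= u k <= v k) -> l2 u <= l2 v.
Proof.
move=> uv; rewrite ler_sqrt ?sum_sqr_ge0//; apply: ler_sum => k _.
by have /andP[u0 kv] := uv k; rewrite lerXn2r ?nnegrE// (le_trans u0).
Qed.

Lemma l2_CS u v : \sum_k u k * v k <= l2 u * l2 v.
Proof.
have l0 w : l2 w = 0 -> forall k, w k = 0.
  move=> /(congr1 (fun t => t ^+ 2)); rewrite l2_sqr expr0n/= => /eqP.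
  rewrite psumr_eq0 => [/allP w0 k|k _]; last exact: sqr_ge0.
  by apply/eqP; rewrite -sqrf_eq0; apply: w0; rewrite mem_index_enum.
have [/l0 u0|u0] := eqVneq (l2 u) 0.
  by rewrite big1 ?mulr_ge0 ?l2_ge0// => k _; rewrite u0 mul0r.
have [/l0 v0|v0] := eqVneq (l2 v) 0.
  by rewrite big1 ?mulr_ge0 ?l2_ge0// => k _; rewrite v0 mulr0.
have a0 : 0 < l2 u by rewrite lt_def u0 l2_ge0.
have b0 : 0 < l2 v by rewrite lt_def v0 l2_ge0.
have : \sum_k (2 * (l2 u * l2 v)) * (u k * v k) <=
    \sum_k (l2 v ^+ 2 * u k ^+ 2 + l2 u ^+ 2 * v k ^+ 2).
  apply: ler_sum => k _; rewrite -subr_ge0.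
  have -> : l2 v ^+ 2 * u k ^+ 2 + l2 u ^+ 2 * v k ^+ 2 - 2 * (l2 u * l2 v) * (u k * v k)
    = (l2 v * u k - l2 u * v k) ^+ 2 by ring.
  exact: sqr_ge0.
rewrite big_split/= -!mulr_sumr -!l2_sqr => h.
have ab : 0 < 2 * (l2 u * l2 v) by rewrite !mulr_gt0.
rewrite -(ler_pM2l ab) (le_trans h)//.
by rewrite le_eqVlt; apply/orP; left; apply/eqP; ring.
Qed.

Lemma l2D u v : l2 (fun k => u k + v k) <= l2 u + l2 v.
Proof.
rewrite -ler_sqr ?nnegrE ?addr_ge0 ?l2_ge0// sqrrD !l2_sqr.
under eq_bigr do rewrite sqrrD.
by rewrite 2!big_split/= lerD2r lerD2l sumrMnl lerMn2r l2_CS.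
Qed.

Lemma l2_0 : l2 (fun=> 0) = 0.
Proof. by rewrite /l2 big1 ?sqrtr0// => k _; rewrite expr0n. Qed.

Lemma l2_sum (I : Type) (s : seq I) (u : I -> 'I_d -> R) :
  l2 (fun k => \sum_(i <- s) u i k) <= \sum_(i <- s) l2 (u i).
Proof.
elim: s => [|i s IHs].
  by rewrite big_nil; under eq_fun do rewrite big_nil; rewrite l2_0.
rewrite big_cons; under eq_fun do rewrite big_cons.
by rewrite (le_trans (l2D _ _))// lerD2l.
Qed.

End EuclideanNorm.

Section EuclideanRadius.
Variables (R : realType) (d : nat) (H : hilbertType R).
Implicit Types (T : optuple d H) (x : H).

Let euclidean_values T := [set Num.sqrt (\sum_k Normc.normc (inner (T k x) x) ^+ 2) |
  x in [set x : H | `|x| = 1]].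

Lemma euclidean_radius_ge0 T : 0 <= euclidean_radius T.
Proof. by apply: sup_ge0 => _ [x _ <-]; exact: sqrtr_ge0. Qed.

Lemma euclidean_values_ub T : has_ubound (euclidean_values T).
Proof.
have /choice[K HK] : forall k, exists K, bounded_by K (T k).
  by move=> k; have [K _ TK] := op_bounded (T k); exists K.
exists (l2 K) => _ [x /= x1 <-]; apply: l2_le => k; rewrite normc_ge0/=.
have xn : nrm x = 1 by rewrite /nrm x1.
by rewrite (le_trans (inner_CS _ _))// xn mulr1 (le_trans (HK k x))// xn mulr1.
Qed.

Lemma euclidean_radius_ub T x :
  l2 (fun k => Normc.normc (inner (T k x) x)) <= euclidean_radius T * nrm x ^+ 2.
Proof.
have [x0|x0] := eqVneq (nrm x) 0.
  rewrite (nrm_eq0 x0) nrm0 expr0n mulr0/= (_ : (fun _ => _) = fun=> 0) ?l2_0//.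
  by apply/funext => k; rewrite linear0r Normc.normc0.
have nx : 0 < nrm x by rewrite lt_def x0 nrm_ge0.
pose c := (nrm x)^-1; pose y := c%:C *: x.
have xy : x = (nrm x)%:C *: y by rewrite scalerA -rmorphM mulfV// scale1r.
have y1 : l2 (fun k => Normc.normc (inner (T k y) y)) <= euclidean_radius T.
  by apply: ub_le_sup; [exact: euclidean_values_ub|exists y => //; exact: nrm_unit].
have -> : (fun k => Normc.normc (inner (T k x) x)) =
    (fun k => nrm x ^+ 2 * Normc.normc (inner (T k y) y)).
  apply/funext => k; rewrite [in LHS]xy opZ innerZl innerZRr mulrA !Normc.normcM.
  by rewrite normcR ger0_norm ?nrm_ge0// -expr2.
have -> : l2 (fun k => nrm x ^+ 2 * Normc.normc (inner (T k y) y)) =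
    nrm x ^+ 2 * l2 (fun k => Normc.normc (inner (T k y) y)).
  rewrite /l2; under eq_bigr do rewrite exprMn.
  by rewrite -mulr_sumr sqrtrM ?sqr_ge0// sqrtr_sqr ger0_norm ?sqr_ge0.
by rewrite mulrC ler_wpM2r ?sqr_ge0.
Qed.

End EuclideanRadius.

Section NumericalRadius.
Variables (R : realType) (n : nat).

Lemma numerical_radius_ge0 (M : 'M[R[i]]_n) : 0 <= numerical_radius M.
Proof. by apply: sup_ge0 => _ [x _ <-]; exact: normc_ge0. Qed.

Lemma normc_sum (I : Type) (s : seq I) (z : I -> R[i]) :
  Normc.normc (\sum_(i <- s) z i) <= \sum_(i <- s) Normc.normc (z i).
Proof.
elim: s => [|i s IHs]; first by rewrite !big_nil Normc.normc0.
by rewrite !big_cons (le_trans (le_normcD _ _))// lerD2l.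
Qed.

Lemma numerical_radius_ub (a : 'I_n -> 'I_n -> R) (u : 'I_n -> R) :
  \sum_i u i ^+ 2 = 1 ->
  \sum_i \sum_j a i j * u i * u j <= numerical_radius (\matrix_(i, j) (a i j)%:C).
Proof.
move=> u1; set M := \matrix_(i, j) _.
have ub : has_ubound [set Normc.normc (\sum_i (M *m x) i 0 * (x i 0)^*) |
    x in [set x : 'cV[R[i]]_n | \sum_i `|x i 0| ^+ 2 = 1]].
  exists (\sum_i \sum_j `|a i j|) => _ [x /= x1 <-].
  have xle i : Normc.normc (x i 0) <= 1.
    have : \sum_i Normc.normc (x i 0) ^+ 2 = 1.
      apply: complexI; rewrite rmorph_sum -[RHS]/(1 : R[i]) -x1.
      by apply: eq_bigr => j _; rewrite rmorphXn.
    rewrite (bigD1 i)//= => h.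
    rewrite -(@ler_pXn2r _ 2) ?nnegrE ?normc_ge0// expr1n -h lerDl.
    by apply: sumr_ge0 => j _; exact: sqr_ge0.
  rewrite (le_trans (normc_sum _ _))//; apply: ler_sum => i _.
  rewrite mxE mulr_suml (le_trans (normc_sum _ _))//; apply: ler_sum => j _.
  rewrite mxE !Normc.normcM normcR -mulrA ler_piMr// mulr_ile1 ?normc_ge0//.
  by have := xle i; rewrite -lecR -norm_normc -norm_conjC norm_normc lecR.
apply: le_trans (ub_le_sup ub _); last first.
  exists (\col_i (u i)%:C) => //=.
  rewrite -[RHS]/(1%:C) -u1 rmorph_sum; apply: eq_bigr => i _ /=.
  by rewrite mxE norm_normc normcR -rmorphXn real_normK ?num_real.
rewrite (_ : \sum_i _ = (\sum_i \sum_j a i j * u i * u j)%:C); last first.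
  rewrite rmorph_sum; apply: eq_bigr => i _ /=.
  rewrite !mxE mulr_suml rmorph_sum; apply: eq_bigr => j _ /=.
  by rewrite !mxE conjR -!rmorphM mulrAC.
by rewrite normcR ler_norm.
Qed.

(** Off-diagonal terms are estimated in symmetric pairs, each pair being counted
    at its index above the diagonal. *)
Lemma sum_upper (b : 'I_n -> 'I_n -> R) :
  \sum_i \sum_j b i j =
  \sum_i \sum_j (if i == j then b i j else if (i < j)%N then b i j + b j i else 0).
Proof.
pose lo (i j : 'I_n) := if (j < i)%N then b i j else 0.
pose up (i j : 'I_n) := if (i < j)%N then b i j else 0.
pose di (i j : 'I_n) := if i == j then b i j else 0.
have S3 (c1 c2 c3 : 'I_n -> 'I_n -> R) : \sum_i \sum_j (c1 i j + c2 i j + c3 i j) =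
    \sum_i \sum_j c1 i j + \sum_i \sum_j c2 i j + \sum_i \sum_j c3 i j.
  rewrite -!big_split; apply: eq_bigr => i _ /=.
  by rewrite -!big_split; apply: eq_bigr.
transitivity (\sum_i \sum_j (di i j + up i j + lo i j)).
  apply: eq_bigr => i _; apply: eq_bigr => j _; rewrite /di /up /lo.
  rewrite -val_eqE/=; by case: ltngtP; rewrite ?addr0 ?add0r.
rewrite S3 [X in _ + _ + X]exchange_big -S3.
apply: eq_bigr => i _; apply: eq_bigr => j _; rewrite /di /up /lo.
by rewrite -val_eqE/=; case: ltngtP; rewrite ?addr0 ?add0r.
Qed.

End NumericalRadius.

Section OffDiagonal.
Variables (R : realType) (H : hilbertType R) (d : nat) (f g : R -> R).
Hypotheses (cf : {within `[0, +oo[, continuous f}) (cg : {within `[0, +oo[, continuous g}).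
Hypothesis fgE : forall t : R, 0 <= t -> f t * g t = t.
Implicit Types (S T : optuple d H) (x y : H).

Definition fg_sum S T : optuple d H :=
  tuple_add (tuple_funcalc_sqr f (tuple_abs S))
            (tuple_funcalc_sqr g (tuple_abs (tuple_adjoint T))).

Lemma fg_sumE S T x k : inner (fg_sum S T k x) x =
  (nrm (funcalc f (absop (S k)) x) ^+ 2 +
   nrm (funcalc g (absop (adjoint (T k))) x) ^+ 2)%:C.
Proof.
have [pS _] := absop_spec (S k); have [pT _] := absop_spec (adjoint (T k)).
by rewrite bopDE innerDl !funcalc_sqrE// -rmorphD.
Qed.

(** The mixed Schwarz inequality bounds the [k]-th entry by the square root of a
    product of values of the quadratic forms of [fg_sum]; the Cauchy-Schwarz
    inequality over [k] then separates the two factors. *)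
Lemma off_diagonal_bound S T x y :
  l2 (fun k => Normc.normc (inner (S k y) x) + Normc.normc (inner (T k x) y)) <=
  Num.sqrt (euclidean_radius (fg_sum T S) * euclidean_radius (fg_sum S T)) *
    nrm x * nrm y.
Proof.
pose P k := Normc.normc (inner (fg_sum T S k x) x).
pose Q k := Normc.normc (inner (fg_sum S T k y) y).
have sq k : (Normc.normc (inner (S k y) x) + Normc.normc (inner (T k x) y)) ^+ 2 <= P k * Q k.
  rewrite /P /Q !fg_sumE !normcR !ger0_norm ?addr_ge0 ?sqr_ge0//.
  have := mixed_schwarz cf cg fgE (S k) y x.
  have := mixed_schwarz cf cg fgE (T k) x y.
  move: (normc_ge0 (inner (S k y) x)) (normc_ge0 (inner (T k x) y)).
  move: (Normc.normc (inner (S k y) x)) (Normc.normc (inner (T k x) y)) => b1 b2.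
  move: (nrm (funcalc f (absop (S k)) y)) (nrm (funcalc g (absop (adjoint (S k))) x)).
  move: (nrm (funcalc f (absop (T k)) x)) (nrm (funcalc g (absop (adjoint (T k))) y)).
  move=> fT gT fS gS b10 b20 h2 h1.
  apply: (@le_trans _ _ ((fS * gS + fT * gT) ^+ 2)).
    by rewrite lerXn2r ?nnegrE ?addr_ge0 ?lerD// ?(le_trans b10 h1) ?(le_trans b20 h2).
  rewrite -subr_ge0 (_ : _ - _ = (gS * gT - fT * fS) ^+ 2) ?sqr_ge0//; ring.
have wx := euclidean_radius_ub (fg_sum T S) x.
have wy := euclidean_radius_ub (fg_sum S T) y.
rewrite -ler_sqr ?nnegrE ?l2_ge0 ?mulr_ge0 ?sqrtr_ge0 ?nrm_ge0// l2_sqr.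
rewrite !exprMn sqr_sqrtr ?mulr_ge0 ?euclidean_radius_ge0//.
rewrite -mulrA mulrACA; apply: le_trans (ler_pM (l2_ge0 _) (l2_ge0 _) wx wy).
by apply: le_trans (l2_CS _ _); apply: ler_sum => k _; exact: sq.
Qed.

End OffDiagonal.

Theorem theorem3p1 (R : realType) (H : hilbertType R) (d n : nat)
    (d_ge1 : (1 <= d)%N) (n_ge1 : (1 <= n)%N)
    (A : 'M[optuple d H]_n) (f g : R -> R)
    (f_ge0 : forall t : R, 0 <= t -> 0 <= f t)
    (g_ge0 : forall t : R, 0 <= t -> 0 <= g t)
    (f_cont : {within `[0, +oo[, continuous f})
    (g_cont : {within `[0, +oo[, continuous g})
    (fgE : forall t : R, 0 <= t -> f t * g t = t) :
  euclidean_radius (tuple_opmx A) <=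
  numerical_radius (\matrix_(i < n, j < n)
    (if i == j then euclidean_radius (A i j)
     else if (i < j)%N then
       Num.sqrt
         (euclidean_radius
            (tuple_add (tuple_funcalc_sqr f (tuple_abs (A j i)))
                       (tuple_funcalc_sqr g (tuple_abs (tuple_adjoint (A i j)))))
          * euclidean_radius
            (tuple_add (tuple_funcalc_sqr f (tuple_abs (A i j)))
                       (tuple_funcalc_sqr g (tuple_abs (tuple_adjoint (A j i))))))
     else 0)%:C).
Proof.
apply: sup_le_ge0 => [|_ [X /= X1 <-]]; first exact: numerical_radius_ge0.
pose u i := nrm (X i).
have u1 : \sum_i u i ^+ 2 = 1.
  have := inner_nrm X; rewrite /(nrm X) X1 expr1n => /(congr1 (@complex.Re R)) /= <-.
  rewrite -[inner X X]/(\sum_i inner (X i) (X i)) raddf_sum.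
  by apply: eq_bigr => i _; rewrite inner_nrm.
apply: le_trans (numerical_radius_ub _ u1).
pose b k i j := Normc.normc (inner (A i j k (X j)) (X i)).
pose e k i j := if i == j then b k i j else if (i < j)%N then b k i j + b k j i else 0.
have b0 k i j : 0 <= b k i j by exact: normc_ge0.
have tri k : Normc.normc (inner (tuple_opmx A k X) X) <= \sum_i \sum_j e k i j.
  rewrite -sum_upper -[inner _ _]/(\sum_i inner (opmx_fun (\matrix_(i, j) A i j k) X i) (X i)).
  rewrite (le_trans (normc_sum _ _))//; apply: ler_sum => i _.
  rewrite ffunE inner_suml (le_trans (normc_sum _ _))//.
  by apply: ler_sum => j _; rewrite mxE.
apply: (@le_trans _ _ (l2 (fun k => \sum_i \sum_j e k i j))).
  by apply: l2_le => k; rewrite normc_ge0 tri.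
apply: le_trans (l2_sum _ _) _; apply: ler_sum => i _.
apply: le_trans (l2_sum _ _) _; apply: ler_sum => j _.
rewrite /e; case: eqVneq => [<-|_].
  by rewrite -mulrA -expr2; exact: euclidean_radius_ub.
case: ifP => _; last by rewrite l2_0 !mul0r.
exact: off_diagonal_bound.
Qed.
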